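(* Let $\Gamma$ be an abelian group, $A$ a $\Gamma$-graded ring and $\Omega$ a subgroup of $\Gamma$. Then there is an equivalence of categories $$\mathrm{Gr}^{\Gamma}\text{-}A\,/\,\mathrm{Gr}_{\Omega}\text{-}A\;\cong\;\mathrm{Gr}^{\Omega}\text{-}A_\Omega .$$ In particular (for $\Omega=0$), $\mathrm{Gr}\text{-}A/\mathrm{Gr}_0\text{-}A\cong\mathrm{Mod}\text{-}A_0$.
   Context: Rings have identity; modules are right modules. $\mathrm{Gr}^{\Gamma}\text{-}A=\mathrm{Gr}\text{-}A$ is the abelian category of $\Gamma$-graded right $A$-modules with degree-preserving homomorphisms. $A_\Omega=\bigoplus_{\omega\in\Omega}A_\omega$, an $\Omega$-graded ring, and $\mathrm{Gr}^{\Omega}\text{-}A_\Omega$ is the category of $\Omega$-graded right $A_\Omega$-modules. $\mathrm{Gr}_\Omega\text{-}A$ is the full subcategory of $\mathrm{Gr}^\Gamma\text{-}A$ of all graded modules $M$ with $M_\omega=0$ for all $\omega\in\Omega$; it is a Serre subcategory, and the quotient is the Serre quotient abelian category (localisation at the morphisms whose kernel and cokernel lie in $\mathrm{Gr}_\Omega\text{-}A$). $\mathrm{Gr}_0\text{-}A$ is the case $\Omega=\{0\}$, and $\mathrm{Mod}\text{-}A_0$ is the category of right $A_0$-modules. *)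

(* Defs.v *)
From HB Require Import structures.
From mathcomp Require Import all_boot all_algebra.
From mathcomp Require Import boolp.
Set Implicit Arguments.
Unset Strict Implicit.
Unset Printing Implicit Defensive.
Import GRing.Theory.
Local Open Scope ring_scope.

Record category := Category {
  ob :> Type;
  hom : ob -> ob -> Type;
  idm : forall X, hom X X;
  compm : forall X Y Z, hom Y Z -> hom X Y -> hom X Z;
  compm1 : forall X Y (f : hom X Y), compm f (idm X) = f;
  comp1m : forall X Y (f : hom X Y), compm (idm Y) f = f;
  compmA : forall X Y Z T (h : hom Z T) (g : hom Y Z) (f : hom X Y),
    compm h (compm g f) = compm (compm h g) f }.

Arguments hom {c} X Y.
Arguments idm {c} X.
Arguments compm {c X Y Z} g f.

Record functor (C D : category) := Functor {
  fob :> C -> D;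
  fmap : forall X Y : C, hom X Y -> hom (fob X) (fob Y);
  fmap_id : forall X : C, fmap (idm X) = idm (fob X);
  fmap_comp : forall (X Y Z : C) (g : hom Y Z) (f : hom X Y),
    fmap (compm g f) = compm (fmap g) (fmap f) }.

Arguments fmap {C D} _ {X Y} _.

Definition functor_id (C : category) : functor C C :=
  {| fob := fun X => X; fmap := fun X Y f => f;
     fmap_id := fun X => erefl; fmap_comp := fun X Y Z g f => erefl |}.

Lemma functor_comp_id (C D E : category) (G : functor D E) (F : functor C D)
  (X : C) : fmap G (fmap F (idm X)) = idm (G (F X)).
Proof. by rewrite !fmap_id. Qed.

Lemma functor_comp_comp (C D E : category) (G : functor D E) (F : functor C D)
    (X Y Z : C) (g : hom Y Z) (f : hom X Y) :
  fmap G (fmap F (compm g f)) =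
  compm (fmap G (fmap F g)) (fmap G (fmap F f)).
Proof. by rewrite !fmap_comp. Qed.

Definition functor_comp (C D E : category) (G : functor D E) (F : functor C D) :
    functor C E :=
  {| fob := fun X => G (F X); fmap := fun X Y f => fmap G (fmap F f);
     fmap_id := functor_comp_id G F; fmap_comp := functor_comp_comp G F |}.

Definition is_iso (C : category) (X Y : C) (f : hom X Y) : Prop :=
  exists g : hom Y X, compm g f = idm X /\ compm f g = idm Y.

Definition naturally_isomorphic (C D : category) (F G : functor C D) : Prop :=
  exists t : forall X : C, hom (F X) (G X),
    (forall (X Y : C) (f : hom X Y),
       compm (t Y) (fmap F f) = compm (fmap G f) (t X)) /\
    (forall X : C, is_iso (t X)).

Definition equivalent_categories (C D : category) : Prop :=
  exists (F : functor C D) (G : functor D C),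
    naturally_isomorphic (functor_comp G F) (functor_id C) /\
    naturally_isomorphic (functor_comp F G) (functor_id D).

Section KernelCokernel.
Variable C : category.

Definition is_zero_object (Z : C) : Prop :=
  forall X : C, (exists! f : hom X Z, True) /\ (exists! f : hom Z X, True).

Definition is_zero_mor (X Y : C) (f : hom X Y) : Prop :=
  exists (Z : C) (a : hom X Z) (b : hom Z Y),
    is_zero_object Z /\ f = compm b a.

Definition is_kernel (X Y : C) (f : hom X Y) (K : C) (k : hom K X) : Prop :=
  is_zero_mor (compm f k) /\
  forall (T : C) (h : hom T X), is_zero_mor (compm f h) ->
    exists! u : hom T K, compm k u = h.

Definition is_cokernel (X Y : C) (f : hom X Y) (Q : C) (q : hom Y Q) : Prop :=
  is_zero_mor (compm q f) /\
  forall (T : C) (h : hom Y T), is_zero_mor (compm h f) ->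
    exists! u : hom Q T, compm u q = h.

End KernelCokernel.

(* Set of classes of a relation; R is intended to be an equivalence. *)
Definition classes (T : Type) (R : T -> T -> Prop) : Type :=
  {P : T -> Prop | exists x, P = R x}.

Definition class_of (T : Type) (R : T -> T -> Prop) (x : T) : classes R :=
  exist _ (R x) (ex_intro _ x erefl).

(* Localisation of C at the class W: same objects, and morphisms freely
   generated by those of C and by a formal inverse of each member of W, modulo
   the smallest congruence giving a category in which C embeds functorially
   and the formal inverses are inverses. *)
Section Localisation.
Variables (C : category) (W : forall X Y : C, hom X Y -> Prop).

Inductive loc_word : C -> C -> Type :=
| LMor X Y of hom X Y : loc_word X Y
| LInv X Y (s : hom X Y) of W s : loc_word Y X
| LComp X Y Z of loc_word Y Z & loc_word X Y : loc_word X Z.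

Inductive loc_eq : forall X Y : C, loc_word X Y -> loc_word X Y -> Prop :=
| loc_refl X Y (p : loc_word X Y) : loc_eq p p
| loc_sym X Y (p q : loc_word X Y) : loc_eq p q -> loc_eq q p
| loc_trans X Y (p q r : loc_word X Y) :
    loc_eq p q -> loc_eq q r -> loc_eq p r
| loc_congr X Y Z (p p' : loc_word Y Z) (q q' : loc_word X Y) :
    loc_eq p p' -> loc_eq q q' -> loc_eq (LComp p q) (LComp p' q')
| loc_assoc X Y Z T (p : loc_word Z T) (q : loc_word Y Z) (r : loc_word X Y) :
    loc_eq (LComp p (LComp q r)) (LComp (LComp p q) r)
| loc_id_r X Y (p : loc_word X Y) : loc_eq (LComp p (LMor (idm X))) p
| loc_id_l X Y (p : loc_word X Y) : loc_eq (LComp (LMor (idm Y)) p) p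
| loc_comp X Y Z (g : hom Y Z) (f : hom X Y) :
    loc_eq (LComp (LMor g) (LMor f)) (LMor (compm g f))
| loc_inv_l X Y (s : hom X Y) (ws : W s) :
    loc_eq (LComp (LInv ws) (LMor s)) (LMor (idm X))
| loc_inv_r X Y (s : hom X Y) (ws : W s) :
    loc_eq (LComp (LMor s) (LInv ws)) (LMor (idm Y)).

Definition loc_hom (X Y : C) : Type := classes (@loc_eq X Y).

Definition loc_class (X Y : C) (p : loc_word X Y) : loc_hom X Y :=
  class_of (@loc_eq X Y) p.

Lemma loc_classP (X Y : C) (p q : loc_word X Y) :
  loc_class p = loc_class q <-> loc_eq p q.
Proof.
split=> [[->]|pq]; first exact: loc_refl.
apply: eq_exist; apply/predeqP => r; split; last exact: loc_trans.
exact/loc_trans/loc_sym.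
Qed.

Lemma loc_class_surj (X Y : C) (a : loc_hom X Y) : exists p, a = loc_class p.
Proof. by case: a => P [p e]; exists p; apply: eq_exist. Qed.

(* The set of all words equal to a product of representatives, i.e. the class
   of LComp p q when a and b are the classes of p and q (loc_hom_compE). *)
Definition loc_hom_comp_pred (X Y Z : C) (a : loc_hom Y Z) (b : loc_hom X Y)
    (r : loc_word X Z) : Prop :=
  exists p q, [/\ sval a p, sval b q & loc_eq (LComp p q) r].

Lemma loc_hom_comp_subproof (X Y Z : C) (a : loc_hom Y Z) (b : loc_hom X Y) :
  exists r, loc_hom_comp_pred a b = @loc_eq X Z r.
Proof.
have [p ->] := loc_class_surj a; have [q ->] := loc_class_surj b.
exists (LComp p q); apply/predeqP => r; split=> [[p' [q' [/= pp qq]]]|e].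
  by apply: loc_trans; apply: loc_congr.
by exists p, q; split=> //; apply: loc_refl.
Qed.

Definition loc_hom_comp (X Y Z : C) (a : loc_hom Y Z) (b : loc_hom X Y) :
    loc_hom X Z := exist _ _ (loc_hom_comp_subproof a b).

Lemma loc_hom_compE (X Y Z : C) (p : loc_word Y Z) (q : loc_word X Y) :
  loc_hom_comp (loc_class p) (loc_class q) = loc_class (LComp p q).
Proof.
apply: eq_exist; apply/predeqP => r; split=> [[p' [q' [/= pp qq]]]|e].
  by apply: loc_trans; apply: loc_congr.
by exists p, q; split=> //; apply: loc_refl.
Qed.

Lemma loc_hom_comp1 (X Y : C) (a : loc_hom X Y) :
  loc_hom_comp a (loc_class (LMor (idm X))) = a.
Proof.
have [p ->] := loc_class_surj a.
by rewrite loc_hom_compE; apply/loc_classP/loc_id_r.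
Qed.

Lemma loc_hom_comp_l1 (X Y : C) (a : loc_hom X Y) :
  loc_hom_comp (loc_class (LMor (idm Y))) a = a.
Proof.
have [p ->] := loc_class_surj a.
by rewrite loc_hom_compE; apply/loc_classP/loc_id_l.
Qed.

Lemma loc_hom_compA (X Y Z T : C)
    (c : loc_hom Z T) (b : loc_hom Y Z) (a : loc_hom X Y) :
  loc_hom_comp c (loc_hom_comp b a) = loc_hom_comp (loc_hom_comp c b) a.
Proof.
have [p ->] := loc_class_surj a; have [q ->] := loc_class_surj b.
have [r ->] := loc_class_surj c.
by rewrite !loc_hom_compE; apply/loc_classP/loc_assoc.
Qed.

Definition localisation : category :=
  {| ob := C; hom := loc_hom; idm := fun X => loc_class (LMor (idm X));
     compm := loc_hom_comp; compm1 := loc_hom_comp1;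
     comp1m := loc_hom_comp_l1; compmA := loc_hom_compA |}.

End Localisation.

(* C / S for the full subcategory of C on the objects satisfying S, intended
   for C abelian and S Serre. As a Serre subcategory is closed under
   isomorphism, it does not matter which kernel and cokernel are used. *)
Definition serre_mor (C : category) (S : C -> Prop) (X Y : C) (f : hom X Y) :
    Prop :=
  (exists (K : C) (k : hom K X), is_kernel f k /\ S K) /\
  (exists (Q : C) (q : hom Y Q), is_cokernel f q /\ S Q).

Definition serre_quotient (C : category) (S : C -> Prop) : category :=
  localisation (@serre_mor C S).

Section DirectSum.
Variables (I : eqType) (V : zmodType) (D : I -> zmodClosed V).

(* x lies in the sum of the subgroups D i for i in P. *)
Definition in_sum (P : {pred I}) (x : V) : Prop :=
  exists2 s : seq (I * V),
    (forall p, p \in s -> p.1 \in P /\ p.2 \in D p.1) &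
    x = \sum_(p <- s) p.2.

Definition independent : Prop :=
  forall (s : seq I) (c : I -> V), uniq s -> (forall i, c i \in D i) ->
    \sum_(i <- s) c i = 0 -> forall i, i \in s -> c i = 0.

Definition direct_sum : Prop := (forall x, in_sum predT x) /\ independent.

Lemma in_sum1 (P : {pred I}) i x : i \in P -> x \in D i -> in_sum P x.
Proof.
move=> iP xD; exists [:: (i, x)]; last by rewrite big_seq1.
by move=> p; rewrite inE => /eqP->.
Qed.

Lemma in_sum0 (P : {pred I}) : in_sum P 0.
Proof. by exists [::]; rewrite ?big_nil. Qed.

Lemma in_sumD (P : {pred I}) x y : in_sum P x -> in_sum P y -> in_sum P (x + y).
Proof.
move=> [s sP ->] [t tP ->]; exists (s ++ t); last by rewrite big_cat.
by move=> p; rewrite mem_cat => /orP[/sP|/tP].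
Qed.

Lemma in_sum_big (P : {pred I}) (J : eqType) (r : seq J) (F : J -> V) :
  (forall j, j \in r -> in_sum P (F j)) -> in_sum P (\sum_(j <- r) F j).
Proof.
move=> h; rewrite big_seq; elim/big_rec: _ => [|j y /h]; first exact: in_sum0.
exact: in_sumD.
Qed.

Lemma in_sumN (P : {pred I}) x : in_sum P x -> in_sum P (- x).
Proof.
move=> [s sP ->]; rewrite -sumrN; apply: in_sum_big => p /sP[pP pD].
by apply: (in_sum1 pP); rewrite rpredN.
Qed.

Lemma in_sum_fun (P : {pred I}) x : in_sum P x ->
  exists (s : seq I) (c : I -> V),
    [/\ uniq s, {subset s <= P}, forall i, c i \in D i
      & x = \sum_(i <- s) c i].
Proof.
move=> [s sP ->].
exists (undup [seq p.1 | p <- s]), (fun i => \sum_(p <- s | p.1 == i) p.2).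
split; first exact: undup_uniq.
- by move=> i; rewrite mem_undup => /mapP[p /sP[pP _] ->].
- move=> i; rewrite big_seq_cond; apply: rpred_sum => p /andP[/sP[_ pD]].
  by move=> /eqP <-.
- rewrite (exchange_big_dep predT) //= big_seq [RHS]big_seq.
  apply: eq_bigr => p ps.
  rewrite -big_filter (@eq_filter _ _ (pred1 p.1)); last first.
    by move=> i; rewrite /= eq_sym.
  rewrite filter_pred1_uniq ?undup_uniq ?mem_undup ?map_f //.
  by rewrite big_seq1.
Qed.

End DirectSum.

Record graded_ring (G : zmodType) := GradedRing {
  gr_ring :> pzRingType;
  gr_comp : G -> zmodClosed gr_ring;
  gr_dsum : direct_sum gr_comp;
  gr_mul : forall (g h : G) (a b : gr_ring),
    a \in gr_comp g -> b \in gr_comp h -> a * b \in gr_comp (g + h) }.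

Lemma gr_one (G : zmodType) (A : graded_ring G) : (1 : A) \in gr_comp A 0.
Proof.
have [sp ind] := gr_dsum A.
have [s [c [us _ cD e1]]] := in_sum_fun (sp 1).
pose e0 := if 0 \in s then c 0 else 0.
have e0D : e0 \in gr_comp A 0 by rewrite /e0; case: ifP => _; rewrite ?cD ?rpred0.
suff h a : a * e0 = a by rewrite -(h 1) mul1r.
have [t tP ->] := sp a; rewrite mulr_suml big_seq [RHS]big_seq.
apply: eq_bigr => -[g {}a] /tP[_ /= aD].
pose d i := (if i \in s then a * c i else 0) - (if i == 0 then a else 0).
have dD i : d i \in gr_comp A (g + i).
  apply: rpredB; first by case: ifP => _; rewrite ?rpred0 ?gr_mul.
  by case: eqP => [->|_]; rewrite ?rpred0 ?addr0.
have [u [uu u0 us']] : exists u, [/\ uniq u, 0 \in u & {subset s <= u}].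
  exists (undup (0 :: s)); rewrite undup_uniq mem_undup inE eqxx.
  by split=> // i si; rewrite mem_undup inE si orbT.
have sumd : \sum_(i <- u) d i = 0.
  rewrite big_split /= sumrN -!big_mkcond /= -big_filter.
  have us_eq : perm_eq (filter (mem s) u) s.
    apply: uniq_perm; rewrite ?filter_uniq // => i; rewrite mem_filter.
    by case si: (i \in s) => /=; rewrite si // us'.
  rewrite (perm_big _ us_eq) /=.
  rewrite -mulr_sumr -e1 mulr1 -big_filter filter_pred1_uniq // big_seq1.
  by rewrite subrr.
have := ind [seq g + i | i <- u] (fun k => d (k - g)) _ _ _ (g + 0).
rewrite (map_inj_uniq (addrI g)) uu big_map.
under eq_bigr do rewrite addrC addKr.
rewrite sumd (map_f (fun i => g + i)) // [g + 0]addrC addrK /d eqxx => k.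
have /eqP : (if 0 \in s then a * c 0 else 0) - a = 0.
  by apply: k => // i; have := dD (i - g); rewrite [g + _]addrC subrK.
by rewrite subr_eq0 /e0 => /eqP; case: ifP => _ //; rewrite mulr0.
Qed.

Section GradedModules.
Variables (G : zmodType) (A : graded_ring G).

(* Right A-modules are left modules over the converse ring A^c; the right
   action of a on m is written a *: m. *)
Record graded_module := GradedModule {
  gm_mod :> lmodType A^c;
  gm_comp : G -> zmodClosed gm_mod;
  gm_dsum : direct_sum gm_comp;
  gm_act : forall (g h : G) (m : gm_mod) (a : A),
    m \in gm_comp g -> a \in gr_comp A h ->
    (a : A^c) *: m \in gm_comp (g + h) }.

Definition degree_preserving (M N : graded_module) (f : M -> N) : Prop :=
  forall (g : G) (m : M), m \in gm_comp M g -> f m \in gm_comp N g.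

Definition graded_hom (M N : graded_module) : Type :=
  {f : {linear M -> N} | degree_preserving f}.

End GradedModules.

Lemma linear_ext (R : pzRingType) (U V : lmodType R) (f g : {linear U -> V}) :
  f =1 g -> f = g.
Proof.
case: f g => [f cf] [g cg] /= /funext e; subst g; congr GRing.Linear.Pack.
by case: cf cg => [[?] [?]] [[?] [?]]; congr GRing.Linear.Class;
  [congr Algebra.isNmodMorphism.Axioms_ | congr GRing.isScalable.Axioms_];
  apply: Prop_irrelevance.
Qed.

Section GradedModuleCategory.
Variables (G : zmodType) (A : graded_ring G).
Implicit Types M N : graded_module A.

Lemma graded_hom_ext M N (f g : graded_hom M N) : sval f =1 sval g -> f = g.
Proof. by case: f g => [f ?] [g ?] /= /linear_ext; apply: eq_exist. Qed.

Definition graded_hom_id M : graded_hom M M :=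
  exist (fun f : {linear M -> M} => degree_preserving f) idfun
    (fun g m h => h).

Definition graded_hom_comp M N P (f : graded_hom N P) (f' : graded_hom M N) :
    graded_hom M P :=
  exist (fun f : {linear M -> P} => degree_preserving f) (sval f \o sval f')
    (fun g m h => svalP f g _ (svalP f' g m h)).

Lemma graded_hom_comp1 M N (f : graded_hom M N) :
  graded_hom_comp f (graded_hom_id M) = f.
Proof. exact: graded_hom_ext. Qed.

Lemma graded_hom_comp_l1 M N (f : graded_hom M N) :
  graded_hom_comp (graded_hom_id N) f = f.
Proof. exact: graded_hom_ext. Qed.

Lemma graded_hom_compA M N P Q
    (h : graded_hom P Q) (g : graded_hom N P) (f : graded_hom M N) :
  graded_hom_comp h (graded_hom_comp g f) =
  graded_hom_comp (graded_hom_comp h g) f.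
Proof. exact: graded_hom_ext. Qed.

Definition Gr : category :=
  {| ob := graded_module A; hom := @graded_hom G A;
     idm := graded_hom_id; compm := graded_hom_comp;
     compm1 := graded_hom_comp1; comp1m := graded_hom_comp_l1;
     compmA := graded_hom_compA |}.

Definition vanishes_on (O : zmodClosed G) (M : Gr) : Prop :=
  forall (g : G) (m : M), g \in O -> m \in gm_comp M g -> m = 0.

End GradedModuleCategory.
Arguments vanishes_on {G} A O M.

Section ModuleCategory.
Variable R : pzRingType.

Definition linear_id (M : lmodType R) : {linear M -> M} := idfun.

Definition linear_comp (M N P : lmodType R)
    (g : {linear N -> P}) (f : {linear M -> N}) : {linear M -> P} := g \o f.

Lemma linear_comp1 (M N : lmodType R) (f : {linear M -> N}) :
  linear_comp f (linear_id M) = f.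
Proof. exact: linear_ext. Qed.

Lemma linear_comp_l1 (M N : lmodType R) (f : {linear M -> N}) :
  linear_comp (linear_id N) f = f.
Proof. exact: linear_ext. Qed.

Lemma linear_compA (M N P Q : lmodType R)
    (h : {linear P -> Q}) (g : {linear N -> P}) (f : {linear M -> N}) :
  linear_comp h (linear_comp g f) = linear_comp (linear_comp h g) f.
Proof. exact: linear_ext. Qed.

Definition left_mod : category :=
  {| ob := lmodType R; hom := fun M N : lmodType R => {linear M -> N};
     idm := linear_id; compm := linear_comp; compm1 := linear_comp1;
     comp1m := linear_comp_l1; compmA := linear_compA |}.

End ModuleCategory.

Definition right_mod (R : pzRingType) : category := left_mod R^c.

Definition subgroup (G : zmodType) (O : zmodClosed G) : Type :=
  {g : G | g \in O}.
HB.instance Definition _ (G : zmodType) (O : zmodClosed G) :=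
  SubChoice.on (subgroup O).
HB.instance Definition _ (G : zmodType) (O : zmodClosed G) :=
  [SubChoice_isSubZmodule of subgroup O by <:].

Definition zero_subgroup (G : zmodType) : {pred G} := pred1 0.
Arguments zero_subgroup G : clear implicits.

Fact zero_subgroup_closed (G : zmodType) : zmod_closed (zero_subgroup G).
Proof.
by split=> [|x y]; rewrite !inE // => /eqP-> /eqP->; rewrite subr0.
Qed.

HB.instance Definition _ (G : zmodType) :=
  GRing.isZmodClosed.Build G (zero_subgroup G) (zero_subgroup_closed G).

Section Restriction.
Variables (G : zmodType) (A : graded_ring G) (O : zmodClosed G).

Definition res_pred : {pred A} := fun x => `[< in_sum (gr_comp A) O x >].

Fact res_subring_closed : subring_closed res_pred.
Proof.
split; first by apply/asboolP/(in_sum1 (rpred0 O))/gr_one.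
- move=> x y /asboolP xA /asboolP yA; apply/asboolP.
  exact/(in_sumD xA)/in_sumN.
- move=> x y /asboolP[s sP ->] /asboolP[t tP ->]; apply/asboolP.
  rewrite mulr_suml; apply: in_sum_big => p /sP[pO pA].
  rewrite mulr_sumr; apply: in_sum_big => q /tP[qO qA].
  exact: in_sum1 (rpredD pO qO) (gr_mul pA qA).
Qed.

HB.instance Definition _ :=
  GRing.isSubringClosed.Build A res_pred res_subring_closed.

Definition res_ring : Type := {x : A | x \in res_pred}.
HB.instance Definition _ := SubChoice.on res_ring.
HB.instance Definition _ :=
  GRing.SubChoice_isSubPzRing.Build A res_pred res_ring res_subring_closed.

Definition res_comp (w : subgroup O) : {pred res_ring} :=
  fun x => val x \in gr_comp A (val w).

Fact res_comp_closed (w : subgroup O) : zmod_closed (res_comp w).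
Proof.
split=> [|x y]; first exact: rpred0.
exact: rpredB.
Qed.

HB.instance Definition _ (w : subgroup O) :=
  GRing.isZmodClosed.Build res_ring (res_comp w) (res_comp_closed w).

Fact res_dsum : direct_sum (res_comp : subgroup O -> zmodClosed res_ring).
Proof.
split=> [x|s c us cD s0 w ws].
  have /asboolP[s sP ex] := valP x.
  suff [y /val_inj <- //] : exists2 y : res_ring, val y = val x &
      in_sum (res_comp : subgroup O -> zmodClosed res_ring) predT y.
  rewrite {}ex; elim: s sP => [|[g a] s IHs] sP.
    by exists 0; [rewrite big_nil | exact: in_sum0].
  have [y ey yP] := IHs (fun p ps => sP p (mem_behead (s := _ :: _) ps)).
  have [/= gO aD] := sP _ (mem_head _ _).
  have aR : a \in res_pred by apply/asboolP/(in_sum1 gO).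
  exists ((Sub a aR : res_ring) + y); first by rewrite big_cons -ey.
  apply: (in_sumD _ yP).
  exact: (@in_sum1 _ _ _ _ (Sub g gO : subgroup O)).
have [_ ind] := gr_dsum A.
pose c' (g : G) : A := if insub g is Some v then val (c (v : subgroup O)) else 0.
have c'E v : c' (val v) = val (c v) by rewrite /c' valK.
apply: val_inj; rewrite -c'E.
apply: (ind [seq val v | v <- s]); last exact: map_f.
- by rewrite map_inj_uniq //; apply: val_inj.
- by move=> g; rewrite /c'; case: insubP => [v _ <-|_]; [exact: cD|rewrite rpred0].
- rewrite big_map; under eq_bigr do rewrite c'E.
  by rewrite -(raddf_sum (val : {additive res_ring -> A})) s0.
Qed.

Fact res_mul (g h : subgroup O) (a b : res_ring) :
  a \in res_comp g -> b \in res_comp h -> a * b \in res_comp (g + h).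
Proof. exact: gr_mul. Qed.

Definition restricted_graded_ring : graded_ring (subgroup O) :=
  {| gr_ring := res_ring; gr_comp := res_comp; gr_dsum := res_dsum;
     gr_mul := res_mul |}.

End Restriction.

Section DegreeZero.
Variables (G : zmodType) (A : graded_ring G).

Definition zero_part_pred : {pred A} := fun x => x \in gr_comp A 0.

Fact zero_part_closed : subring_closed zero_part_pred.
Proof.
split; first exact: gr_one.
- move=> x y; exact: rpredB.
- by move=> x y xA yA; rewrite /zero_part_pred unfold_in -[0]addr0 gr_mul.
Qed.

HB.instance Definition _ :=
  GRing.isSubringClosed.Build A zero_part_pred zero_part_closed.

Definition zero_part : Type := {x : A | x \in zero_part_pred}.
HB.instance Definition _ := SubChoice.on zero_part.
HB.instance Definition _ :=
  GRing.SubChoice_isSubPzRing.Build A zero_part_pred zero_part zero_part_closed.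

End DegreeZero.

(* Main.v *)
From HB Require Import structures.
From mathcomp Require Import all_boot all_algebra.
From mathcomp Require Import boolp functions.
Require Import Defs.
Set Implicit Arguments.
Unset Strict Implicit.
Unset Printing Implicit Defensive.
Import GRing.Theory.
Local Open Scope ring_scope.

(** Write O for the subgroup and A_O for the restricted ring. Restriction to the
    degrees in O, M |-> M_O, is a functor from Gr A to Gr A_O, and it is the
    quotient functor because it inverts the same morphisms as the Serre quotient
    and has a right adjoint for which the counit is an isomorphism.

    The adjoint sends N to the graded module of A_O-linear maps f : A -> N, with
    A acting by (f x) a = f (x a): the sum over g of the maps that send each A_h
    to N_(g+h), where N_(g+h) is 0 if g + h is not in O. In a degree g in O such
    a map vanishes outside A_O, hence is determined by f 1, which can be any
    element of N_g; so evaluation at 1 is an isomorphism from the restriction of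
    the adjoint back to N (counit_iso). The unit sends m in M to the map taking
    a to the O-part of m a.

    A morphism has kernel and cokernel vanishing in the degrees of O if and only
    if it is bijective in these degrees, that is, if and only if its restriction
    to O is an isomorphism (serre_morP, serre_mor_res). For this, kernels and
    cokernels of graded modules are constructed. The restriction of the unit is
    an isomorphism by a triangle identity, so the unit is one of the morphisms
    inverted by the Serre quotient (unit_serre_mor).

    The rest is formal (localisation_equivalence). Restriction inverts the class
    of morphisms in question, so it factors through the localisation. The adjoint
    followed by the localisation is inverse to this factor: one composite is
    isomorphic to the identity by the counit, the other by the unit, which has
    become invertible.

    For O = 0 the ring A_O is A_0, and a grading by the trivial group is no
    additional structure, so Gr A_O is equivalent to the category of
    A_0-modules (degree_zero_equiv). *)

(** * Categories, localisations and equivalences *)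

Section Isomorphisms.
Variable C : category.

Definition iso_inv (X Y : C) (f : hom X Y) (h : is_iso f) : hom Y X :=
  sval (cid h).

Lemma iso_invl (X Y : C) (f : hom X Y) (h : is_iso f) :
  compm (iso_inv h) f = idm X.
Proof. by rewrite /iso_inv; case: cid => g []. Qed.

Lemma iso_invr (X Y : C) (f : hom X Y) (h : is_iso f) :
  compm f (iso_inv h) = idm Y.
Proof. by rewrite /iso_inv; case: cid => g []. Qed.

Lemma is_iso_inv (X Y : C) (f : hom X Y) (h : is_iso f) : is_iso (iso_inv h).
Proof. by exists f; rewrite iso_invl iso_invr. Qed.

Lemma is_iso_comp (X Y Z : C) (g : hom Y Z) (f : hom X Y) :
  is_iso g -> is_iso f -> is_iso (compm g f).
Proof.
move=> [g' [gl gr]] [f' [fl fr]]; exists (compm f' g'); split.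
  by rewrite compmA -(compmA f') gl compm1 fl.
by rewrite compmA -(compmA g) fr compm1 gr.
Qed.

Lemma is_iso_linv (X Y : C) (f : hom X Y) (g : hom Y X) :
  is_iso g -> compm g f = idm X -> is_iso f.
Proof.
move=> ig gf; suff -> : f = iso_inv ig by exact: is_iso_inv.
by rewrite -[f]comp1m -(iso_invl ig) -compmA gf compm1.
Qed.

Lemma square_inv (X Y X' Y' : C) (s : hom X Y) (s' : hom X' Y')
    (r : hom Y X) (r' : hom Y' X') (tX : hom X' X) (tY : hom Y' Y) :
  compm r s = idm X -> compm s' r' = idm Y' ->
  compm tY s' = compm s tX -> compm tX r' = compm r tY.
Proof.
move=> rs sr tN; rewrite -[LHS]comp1m -rs -compmA (compmA s) -tN.
by rewrite -(compmA tY) sr compm1.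
Qed.

End Isomorphisms.

Lemma is_iso_fmap (C D : category) (F : functor C D) (X Y : C) (f : hom X Y) :
  is_iso f -> is_iso (fmap F f).
Proof.
by move=> [g [gf fg]]; exists (fmap F g); rewrite -!fmap_comp gf fg !fmap_id.
Qed.

Lemma equivalent_categories_trans (C D E : category) :
  equivalent_categories C D -> equivalent_categories D E ->
  equivalent_categories C E.
Proof.
move=> [F [G [[a [aN aI]] [b [bN bI]]]]] [F' [G' [[a' [aN' aI']] [b' [bN' bI']]]]].
exists (functor_comp F' F), (functor_comp G G'); split.
- exists (fun X => compm (a X) (fmap G (a' (F X)))); split=> [X Y f|X].
    rewrite /= -compmA -fmap_comp (aN' _ _ (fmap F f)) fmap_comp !compmA.
    by congr compm; apply: aN.
  by apply: is_iso_comp; [exact: aI|exact: (is_iso_fmap G (aI' _))].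
- exists (fun X => compm (b' X) (fmap F' (b (G' X)))); split=> [X Y f|X].
    rewrite /= -compmA -fmap_comp (bN _ _ (fmap G' f)) fmap_comp !compmA.
    by congr compm; apply: bN'.
  by apply: is_iso_comp; [exact: bI'|exact: (is_iso_fmap F' (bI _))].
Qed.

Section LocalisationFunctor.
Variables (C D : category) (W : forall X Y : C, hom X Y -> Prop).

Definition loc_in_fun (X Y : C) (f : hom X Y) :
  @hom (localisation W) X Y := loc_class (LMor W f).

Lemma loc_in_comp (X Y Z : C) (g : hom Y Z) (f : hom X Y) :
  loc_in_fun (compm g f) = compm (loc_in_fun g) (loc_in_fun f).
Proof. by rewrite /= loc_hom_compE; apply/loc_classP/loc_sym/loc_comp. Qed.

Definition loc_in : functor C (localisation W) :=
  {| fob := fun X : C => (X : localisation W); fmap := loc_in_fun;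
     fmap_id := fun X => erefl; fmap_comp := loc_in_comp |}.

Lemma loc_in_iso (X Y : C) (s : hom X Y) : W s -> is_iso (fmap loc_in s).
Proof.
move=> ws; exists (loc_class (LInv ws)) => /=; rewrite !loc_hom_compE.
by split; apply/loc_classP; [exact: loc_inv_l|exact: loc_inv_r].
Qed.

Variables (F : functor C D)
  (FW : forall (X Y : C) (s : hom X Y), W s -> is_iso (fmap F s)).

Fixpoint word_map (X Y : C) (p : loc_word W X Y) : hom (F X) (F Y) :=
  match p with
  | LMor _ _ f => fmap F f
  | LInv _ _ s ws => iso_inv (FW ws)
  | LComp _ _ _ p q => compm (word_map p) (word_map q)
  end.

(** Each generator of the congruence is an identity that holds in D as soon as
    formal inverses are sent to inverses; this gives one half of the universal
    property of the localisation. *)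
Lemma word_map_eq (X Y : C) (p q : loc_word W X Y) :
  loc_eq p q -> word_map p = word_map q.
Proof.
elim=> {X Y p q} //=.
- by move=> X Y p q r _ -> _ ->.
- by move=> X Y Z p p' q q' _ -> _ ->.
- by move=> *; rewrite compmA.
- by move=> *; rewrite fmap_id compm1.
- by move=> *; rewrite fmap_id comp1m.
- by move=> *; rewrite fmap_comp.
- by move=> *; rewrite iso_invl fmap_id.
- by move=> *; rewrite iso_invr fmap_id.
Qed.

Definition loc_map (X Y : C) (a : loc_hom W X Y) : hom (F X) (F Y) :=
  word_map (sval (cid (loc_class_surj a))).

Lemma loc_mapE (X Y : C) (p : loc_word W X Y) :
  loc_map (loc_class p) = word_map p.
Proof.
by rewrite /loc_map; case: cid => q /= /loc_classP/loc_sym/word_map_eq.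
Qed.

Lemma loc_map_comp (X Y Z : C) (b : loc_hom W Y Z) (a : loc_hom W X Y) :
  loc_map (loc_hom_comp b a) = compm (loc_map b) (loc_map a).
Proof.
have [p ->] := loc_class_surj a; have [q ->] := loc_class_surj b.
by rewrite loc_hom_compE !loc_mapE.
Qed.

Lemma loc_map_id (X : C) : loc_map (loc_class (LMor W (idm X))) = idm (F X).
Proof. by rewrite loc_mapE /= fmap_id. Qed.

Definition loc_functor : functor (localisation W) D :=
  {| fob := fun X : localisation W => F X; fmap := loc_map;
     fmap_id := loc_map_id; fmap_comp := loc_map_comp |}.

(** A naturality square that commutes for s commutes for the formal inverse of
    s, by inverting two of its sides; so it is enough to test naturality on the
    morphisms of C. *)
Lemma loc_natural (K : functor (localisation W) (localisation W))
    (t : forall X : C, @hom (localisation W) (K X) X) :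
  (forall (X Y : C) (f : hom X Y),
    compm (t Y) (fmap K (fmap loc_in f)) = compm (fmap loc_in f) (t X)) ->
  forall (X Y : C) (a : @hom (localisation W) X Y),
    compm (t Y) (fmap K a) = compm a (t X).
Proof.
move=> tN X Y a; have [p {a}->] := loc_class_surj a.
elim: p => {X Y} [X Y f|X Y s ws|X Y Z p IHp q IHq].
- exact: tN.
- pose r : @hom (localisation W) Y X := loc_class (LInv ws).
  have [e1 e2] : compm r (fmap loc_in s) = idm _ /\
      compm (fmap loc_in s) r = idm _.
    rewrite /= !loc_hom_compE.
    by split; apply/loc_classP; [exact: loc_inv_l|exact: loc_inv_r].
  apply: (square_inv e1 _ (tN _ _ s)).
  by rewrite -fmap_comp e2 fmap_id.
- rewrite -(loc_hom_compE p q); rewrite (fmap_comp K (loc_class p)).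
  by rewrite [LHS]compmA IHp -[LHS]compmA IHq [LHS]compmA.
Qed.

Variables (H : functor D C) (eta : forall X : C, hom X (H (F X)))
  (eps : forall Y : D, hom (F (H Y)) Y).
Hypothesis eta_nat : forall (X Y : C) (f : hom X Y),
  compm (eta Y) f = compm (fmap H (fmap F f)) (eta X).
Hypothesis etaW : forall X : C, W (eta X).
Hypothesis eps_nat : forall (X Y : D) (f : hom X Y),
  compm (eps Y) (fmap F (fmap H f)) = compm f (eps X).
Hypothesis eps_iso : forall Y : D, is_iso (eps Y).

(** The unit eta lies in W, hence becomes invertible in the localisation, while
    eps is invertible in D: these are the two natural isomorphisms. *)
Lemma localisation_equivalence : equivalent_categories (localisation W) D.
Proof.
exists loc_functor, (functor_comp loc_in H); split.
- exists (fun X => iso_inv (loc_in_iso (etaW X))); split=> [|X]; last first.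
    exact: is_iso_inv.
  apply: loc_natural => X Y f; apply/esym.
  apply: (square_inv (iso_invl _) (iso_invr _)).
  rewrite -[RHS](fmap_comp loc_in) eta_nat [RHS](fmap_comp loc_in).
  by rewrite /= loc_mapE.
- exists eps; split=> // X Y f /=.
  by rewrite loc_mapE; apply: eps_nat.
Qed.

End LocalisationFunctor.

(** * Direct sums *)

(** Linear maps and closed predicates often depend on proofs here, so they are
    packed as terms rather than found by inference on a head constant. *)
Definition linear_pack (R : pzRingType) (U V : lmodType R) (f : U -> V)
    (lf : linear f) : {linear U -> V} :=
  HB.pack f (GRing.isLinear.Build R U V *:%R f lf).

Definition prop_pred (T : Type) (P : T -> Prop) : {pred T} :=
  fun x => `[< P x >].

Lemma prop_predP (T : Type) (P : T -> Prop) (x : T) :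
  reflect (P x) (x \in prop_pred P).
Proof. exact: asboolP. Qed.

Lemma zmod_closed_prop (V : zmodType) (P : V -> Prop) :
  P 0 -> (forall x y, P x -> P y -> P (x - y)) -> zmod_closed (prop_pred P).
Proof.
move=> P0 PB; split=> [|x y /prop_predP Px /prop_predP Py]; apply/prop_predP.
  exact: P0.
exact: PB.
Qed.

Definition zmod_closed_pack (V : zmodType) (P : {pred V}) (cP : zmod_closed P) :
    zmodClosed V :=
  HB.pack P (GRing.isZmodClosed.Build V P cP).

Section DirectSumFacts.
Variables (I : eqType) (V : zmodType) (D : I -> zmodClosed V).
Implicit Types (P Q : {pred I}) (x y : V).

Lemma in_sum_ind P x :
  in_sum D P x -> forall K : V -> Prop,
  K 0 -> (forall x y, K x -> K y -> K (x + y)) ->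
  (forall i x, i \in P -> x \in D i -> K x) -> K x.
Proof.
move=> [s sP ->] K K0 KD K1; rewrite big_seq; elim/big_rec: _ => // p y /sP[].
by move=> pP pD; apply: KD; apply: K1 pP pD.
Qed.

Lemma in_sum_sub P Q x : {subset P <= Q} -> in_sum D P x -> in_sum D Q x.
Proof. by move=> PQ [s sP ->]; exists s => // p /sP[/PQ]. Qed.

Lemma in_sum_pred1 i x : in_sum D (pred1 i) x -> x \in D i.
Proof.
move=> xi; elim/(in_sum_ind xi): _.
- exact: rpred0.
- by move=> y z; apply: rpredD.
- by move=> j y /eqP->.
Qed.

Lemma in_sum_disjoint P x :
  independent D -> in_sum D P x -> in_sum D [predC P] x -> x = 0.
Proof.
move=> ind /in_sum_fun[s [c [us sP cD xc]]] /in_sum_fun[t [d [ut tP dD xd]]].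
have ne i : i \in t -> i \in s = false.
  by move=> /tP; rewrite !inE => iP; apply/negP => /sP; apply/negP.
pose e i := if i \in s then c i else - d i.
rewrite xc big_seq big1 // => i si.
have <- : e i = c i by rewrite /e si.
apply: (ind (s ++ t)); last by rewrite mem_cat si.
- rewrite cat_uniq us ut andbT /=.
  by apply/hasPn => j tj; rewrite /= (ne _ tj).
- by move=> j; rewrite /e; case: ifP => _; rewrite ?rpredN ?cD ?dD.
- rewrite big_cat /= big_seq (eq_bigr c) => [|j]; last by rewrite /e => ->.
  rewrite -big_seq -xc big_seq (eq_bigr (fun j => - d j)) => [|j tj].
    by rewrite -big_seq sumrN -xd subrr.
  by rewrite /e (ne _ tj).
Qed.

Lemma independent_disjoint :
  (forall i x, x \in D i -> in_sum D (predC1 i) x -> x = 0) -> independent D.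
Proof.
move=> dis s c us cD s0 i si; apply: (dis i) => //.
move: s0; rewrite (bigD1_seq i) //= => /eqP; rewrite addr_eq0 => /eqP->.
apply: in_sumN; rewrite -big_filter; apply: in_sum_big => j.
by rewrite mem_filter => /andP[ji _]; apply: in_sum1 (cD j).
Qed.

Hypothesis dD : direct_sum D.

Lemma direct_sum_ext (W : zmodType) (f g : V -> W) :
  (forall x y, f (x + y) = f x + f y) -> (forall x y, g (x + y) = g x + g y) ->
  (forall i x, x \in D i -> f x = g x) -> f =1 g.
Proof.
move=> fD gD fg x; elim/(in_sum_ind (dD.1 x)): _.
- have f0 : f 0 = 0 by apply: (addIr (f 0)); rewrite -fD !add0r.
  by rewrite f0; apply: (addIr (g 0)); rewrite -gD !add0r.
- by move=> y z fy fz; rewrite fD gD fy fz.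
- by move=> i y _; apply: fg.
Qed.

Lemma direct_sum_split P x :
  exists y, in_sum D P y /\ in_sum D [predC P] (x - y).
Proof.
elim/(in_sum_ind (dD.1 x)): _.
- by exists 0; rewrite subr0; split; apply: in_sum0.
- move=> y z [y' [y1 y2]] [z' [z1 z2]]; exists (y' + z').
  by rewrite opprD addrACA; split; apply: in_sumD.
- move=> i y _ yD; case iP: (i \in P).
    by exists y; rewrite subrr; split; [apply: in_sum1 yD|apply: in_sum0].
  exists 0; rewrite subr0; split; first exact: in_sum0.
  by apply: in_sum1 yD; rewrite !inE iP.
Qed.

(** The projection onto the sum of the D i for i in P, along the sum of the
    others. *)
Definition proj P x : V := sval (cid (direct_sum_split P x)).

Lemma proj_in P x : in_sum D P (proj P x).
Proof. by rewrite /proj; case: cid => y []. Qed.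

Lemma proj_compl P x : in_sum D [predC P] (x - proj P x).
Proof. by rewrite /proj; case: cid => y []. Qed.

Lemma proj_unique P x y :
  in_sum D P y -> in_sum D [predC P] (x - y) -> proj P x = y.
Proof.
move=> yP xyP; apply/eqP; rewrite -subr_eq0; apply/eqP.
apply: (@in_sum_disjoint P _ dD.2).
  by apply: in_sumD (proj_in _ _) _; apply: in_sumN.
have -> : proj P x - y = (x - y) - (x - proj P x).
  by rewrite [RHS]addrC opprB -addrA addKr.
by apply: in_sumD => //; apply/in_sumN/proj_compl.
Qed.

Lemma proj_id P x : in_sum D P x -> proj P x = x.
Proof. by move=> xP; apply: proj_unique; rewrite ?subrr //; apply: in_sum0. Qed.

Lemma proj_eq0 P x : in_sum D [predC P] x -> proj P x = 0.
Proof. by move=> xP; apply: proj_unique; rewrite ?subr0 //; apply: in_sum0. Qed.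

Lemma projD P x y : proj P (x + y) = proj P x + proj P y.
Proof.
apply: proj_unique; first by apply: in_sumD; apply: proj_in.
by rewrite opprD addrACA; apply: in_sumD; apply: proj_compl.
Qed.

End DirectSumFacts.

Lemma proj_morph (I : eqType) (V V' : zmodType) (D : I -> zmodClosed V)
    (D' : I -> zmodClosed V') (dD : direct_sum D) (dD' : direct_sum D')
    (P : {pred I}) (u : V -> V') :
  {morph u : x y / x - y} ->
  (forall x, in_sum D P x -> in_sum D' P (u x)) ->
  (forall x, in_sum D [predC P] x -> in_sum D' [predC P] (u x)) ->
  forall x, proj dD' P (u x) = u (proj dD P x).
Proof.
move=> uB uP uPC x; apply: proj_unique; first exact/uP/proj_in.
by rewrite -uB; apply/uPC/proj_compl.
Qed.

Lemma in_sum_biadd (G : zmodType) (U V W : zmodType) (D : G -> zmodClosed U)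
    (E : G -> zmodClosed V) (F : G -> zmodClosed W) (op : U -> V -> W)
    (P Q K : {pred G}) :
  (forall x y z, op (x + y) z = op x z + op y z) ->
  (forall x y z, op x (y + z) = op x y + op x z) ->
  (forall g h x y, x \in D g -> y \in E h -> op x y \in F (g + h)) ->
  (forall g h, g \in P -> h \in Q -> g + h \in K) ->
  forall x y, in_sum D P x -> in_sum E Q y -> in_sum F K (op x y).
Proof.
move=> opDl opDr opF PQ x y xP yQ.
have op0l z : op 0 z = 0 by apply: (addIr (op 0 z)); rewrite -opDl !add0r.
have op0r z : op z 0 = 0 by apply: (addIr (op z 0)); rewrite -opDr !add0r.
elim/(in_sum_ind xP): _ => [|x1 x2 h1 h2|g x' gP xg].
- by rewrite op0l; apply: in_sum0.
- by rewrite opDl; apply: in_sumD.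
elim/(in_sum_ind yQ): _ => [|y1 y2 h1 h2|h y' hQ yh].
- by rewrite op0r; apply: in_sum0.
- by rewrite opDr; apply: in_sumD.
- exact: in_sum1 (PQ _ _ gP hQ) (opF _ _ _ _ xg yh).
Qed.

(** Multiplication by y shifts degrees by elements of the subgroup O, so it
    sends degrees in O to degrees in O, and the others to the others. *)
Lemma proj_biadd (G : zmodType) (U V W : zmodType) (D : G -> zmodClosed U)
    (E : G -> zmodClosed V) (F : G -> zmodClosed W) (dD : direct_sum D)
    (dF : direct_sum F) (op : U -> V -> W) (O : zmodClosed G) (y : V) :
  (forall x y z, op (x + y) z = op x z + op y z) ->
  (forall x y z, op x (y + z) = op x y + op x z) ->
  (forall g h x y, x \in D g -> y \in E h -> op x y \in F (g + h)) ->
  in_sum E O y -> forall x, proj dF O (op x y) = op (proj dD O x) y.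
Proof.
move=> opDl opDr opF yO.
have stable := in_sum_biadd opDl opDr opF.
apply: (@proj_morph _ _ _ _ _ _ _ _ (op^~ y)) => [x z|x xO|x xO].
- by apply: (addIr (op z y)); rewrite -opDl !subrK.
- by apply: (stable _ _ _ _ _ _ xO yO) => g h; apply: rpredD.
- apply: (stable _ _ _ _ _ _ xO yO) => g h; rewrite !inE => gO hO.
  by rewrite rpredDr.
Qed.

(** * Graded modules *)

Section GradedFamily.
Variables (G : zmodType) (A : graded_ring G).

(** Kernels, restrictions and coinduced modules are all cut out, one degree at
    a time, inside a module that may be larger than the sum of the degrees. This
    record is that situation: a graded module without the spanning axiom. *)
Record graded_family := GradedFamily {
  gf_mod :> lmodType A^c;
  gf_comp : G -> zmodClosed gf_mod;
  gf_ind : independent gf_comp;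
  gf_act : forall (g h : G) (m : gf_mod) (a : A),
    m \in gf_comp g -> a \in gr_comp A h ->
    (a : A^c) *: m \in gf_comp (g + h) }.

Variable L : graded_family.

Definition gsum_pred : {pred L} := prop_pred (in_sum (gf_comp L) predT).

Lemma gsum_submod_closed : submod_closed gsum_pred.
Proof.
split; first exact/prop_predP/in_sum0.
move=> a x y /prop_predP xL /prop_predP yL; apply/prop_predP/in_sumD => //.
apply: (in_sum_biadd (op := fun (x : L) (a : A) => (a : A^c) *: x)
  _ _ _ _ xL ((gr_dsum A).1 a)) => // [y' z c|y' c d|g h m c].
- exact: scalerDr.
- exact: scalerDl.
- exact: gf_act.
Qed.

Definition gsum_type : Type := {x : L | x \in gsum_pred}.
HB.instance Definition _ := SubChoice.on gsum_type.
HB.instance Definition _ :=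
  GRing.SubChoice_isSubLmodule.Build _ L gsum_pred gsum_type gsum_submod_closed.

Definition gsum_comp_pred (g : G) : {pred gsum_type} :=
  fun x => val x \in gf_comp L g.

Lemma gsum_comp_closed (g : G) : zmod_closed (gsum_comp_pred g).
Proof. by split=> [|x y]; [exact: rpred0|exact: rpredB]. Qed.

Definition gsum_comp (g : G) : zmodClosed gsum_type :=
  zmod_closed_pack (gsum_comp_closed g).

Lemma gsum_dsum : direct_sum gsum_comp.
Proof.
split=> [x|s c us cD s0 i si].
  have /prop_predP xL := valP x.
  suff: exists2 y : gsum_type, val y = val x & in_sum gsum_comp predT y.
    by move=> [y /val_inj <-].
  elim/(in_sum_ind xL): _ => [|_ _ [y <- yS] [z <- zS]|g y _ yg].
  - by exists 0 => //; apply: in_sum0.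
  - by exists (y + z) => //; apply: in_sumD.
  - have yL : y \in gsum_pred by apply/prop_predP/(in_sum1 (i := g)).
    by exists (Sub y yL) => //; apply: (in_sum1 (i := g)).
apply: val_inj; apply: (gf_ind (s := s) (c := fun i => val (c i))) => //.
by rewrite -(raddf_sum (val : {additive gsum_type -> L})) s0.
Qed.

Lemma gsum_act (g h : G) (m : gsum_type) (a : A) :
  m \in gsum_comp g -> a \in gr_comp A h -> (a : A^c) *: m \in gsum_comp (g + h).
Proof. exact: gf_act. Qed.

Definition gsum : graded_module A :=
  {| gm_mod := gsum_type; gm_comp := gsum_comp; gm_dsum := gsum_dsum;
     gm_act := gsum_act |}.

Lemma gsum_val_linear : linear (val : gsum -> L).
Proof. by []. Qed.

Variables (M : graded_module A) (u : {linear M -> L}).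
Hypothesis uD : forall (g : G) (m : M), m \in gm_comp M g -> u m \in gf_comp L g.

Lemma gsum_lift_subproof (m : M) : u m \in gsum_pred.
Proof.
apply/prop_predP; elim/(in_sum_ind ((gm_dsum M).1 m)): _.
- by rewrite raddf0; apply: in_sum0.
- by move=> x y xP yP; rewrite raddfD; apply: in_sumD.
- by move=> g x _ /uD; apply: in_sum1.
Qed.

Definition gsum_lift_fun (m : M) : gsum := Sub (u m) (gsum_lift_subproof m).

Lemma gsum_lift_linear : linear gsum_lift_fun.
Proof. by move=> a x y; apply: val_inj; rewrite /= linearP. Qed.

Definition gsum_lift : graded_hom M gsum :=
  exist (fun f : {linear M -> gsum} => degree_preserving f)
    (linear_pack gsum_lift_linear) uD.

End GradedFamily.

Lemma gsum_in (G : zmodType) (A : graded_ring G) (L : graded_family A) (g : G)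
  (x : L) : x \in gf_comp L g -> x \in @gsum_pred _ _ L.
Proof. by move=> xg; apply/prop_predP/(in_sum1 (i := g)). Qed.

(** With gsum_valZ, this unfolds the operations of nested sums one layer at a
    time. *)
Lemma gsum_valD (G : zmodType) (A : graded_ring G) (L : graded_family A)
  (x y : gsum L) : val (x + y) = val x + val y.
Proof. by []. Qed.

Lemma gsum_valZ (G : zmodType) (A : graded_ring G) (L : graded_family A)
  (a : A^c) (x : gsum L) : val (a *: x) = a *: val x.
Proof. by []. Qed.

Section GsumMap.
Variables (G : zmodType) (A : graded_ring G) (L L' : graded_family A).
Variable u : {linear L -> L'}.
Hypothesis uD : forall (g : G) (x : L), x \in gf_comp L g -> u x \in gf_comp L' g.

Lemma gsum_map_linear : linear (fun x : gsum L => u (val x)).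
Proof. by move=> a x y; rewrite /= linearP. Qed.

Definition gsum_map : graded_hom (gsum L) (gsum L') :=
  gsum_lift (u := linear_pack gsum_map_linear) (fun g x => @uD g (val x)).

End GsumMap.

Section GradedHom.
Variables (G : zmodType) (A : graded_ring G).
Implicit Types M N : graded_module A.

Definition ghom_pack M N (f : M -> N) (lf : linear f)
    (df : degree_preserving f) : graded_hom M N :=
  exist (fun f : {linear M -> N} => degree_preserving f) (linear_pack lf) df.

Lemma graded_hom_in_sum M N (f : graded_hom M N) (P : {pred G}) x :
  in_sum (gm_comp M) P x -> in_sum (gm_comp N) P (sval f x).
Proof.
move=> xP; elim/(in_sum_ind xP): _ => [|u v hu hv|g u gP ug].
- by rewrite linear0; apply: in_sum0.
- by rewrite linearD; apply: in_sumD.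
- by apply: (in_sum1 gP); apply: (svalP f).
Qed.

Lemma graded_hom_proj M N (f : graded_hom M N) (P : {pred G}) x :
  proj (gm_dsum N) P (sval f x) = sval f (proj (gm_dsum M) P x).
Proof.
apply: (proj_morph (gm_dsum M) (gm_dsum N) (linearB (sval f))) => y.
  exact: graded_hom_in_sum.
exact: graded_hom_in_sum.
Qed.

(** Bijectivity can be tested one degree at a time, since a relation between
    components of different degrees is trivial. The inverse preserves degrees:
    the components of a preimage of y outside the degree of y map to 0. *)
Lemma graded_iso M N (f : graded_hom M N) :
  (forall g m, m \in gm_comp M g -> sval f m = 0 -> m = 0) ->
  (forall g n, n \in gm_comp N g -> exists m, sval f m = n) ->
  @is_iso (Gr A) M N f.
Proof.
move=> f_inj f_surj.
have finj x : sval f x = 0 -> x = 0.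
  move=> fx; have [s [c [us _ cD ex]]] := in_sum_fun ((gm_dsum M).1 x).
  rewrite ex big_seq big1 // => i si; apply: (f_inj i) => //.
  apply: ((gm_dsum N).2 s (fun i => sval f (c i)) us) => // [j|].
    exact: (svalP f).
  by rewrite -raddf_sum -ex.
have fsurj y : exists x, sval f x = y.
  elim/(in_sum_ind ((gm_dsum N).1 y)): _ => [|_ _ [x <-] [x' <-]|g n _].
  - by exists 0; rewrite raddf0.
  - by exists (x + x'); rewrite raddfD.
  - exact: f_surj.
have fI x x' : sval f x = sval f x' -> x = x'.
  move=> e; apply/eqP; rewrite -subr_eq0; apply/eqP/finj.
  by rewrite linearB e subrr.
pose h y := sval (cid (fsurj y)).
have fh y : sval f (h y) = y by rewrite /h; case: cid.
have lh : linear h by move=> a x y; apply: fI; rewrite linearP !fh.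
have dh : degree_preserving h.
  move=> g y yg; suff <- : proj (gm_dsum M) (pred1 g) (h y) = h y.
    exact/in_sum_pred1/proj_in.
  apply: fI; rewrite -graded_hom_proj fh; apply: proj_id.
  by apply: in_sum1 yg; apply: eqxx.
exists (ghom_pack lh dh); split; apply: graded_hom_ext => x /=; last exact: fh.
by apply: fI; rewrite fh.
Qed.

Lemma graded_iso_inj M N (f : graded_hom M N) :
  @is_iso (Gr A) M N f -> forall m, sval f m = 0 -> m = 0.
Proof.
move=> [h [/(congr1 (fun k => sval k)) hf _]] m fm.
by have /(congr1 (fun k : {linear M -> M} => k m)) /= := hf; rewrite fm raddf0.
Qed.

Lemma graded_iso_surj M N (f : graded_hom M N) :
  @is_iso (Gr A) M N f -> forall n, exists m, sval f m = n.
Proof.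
move=> [h [_ /(congr1 (fun k => sval k)) fh]] n.
by exists (sval h n); have /(congr1 (fun k : {linear N -> N} => k n)) := fh.
Qed.

End GradedHom.

(** * Quotient modules *)

Section QuotientModule.
Variables (R : pzRingType) (M N : lmodType R) (f : {linear M -> N}).

Lemma image_closed :
  zmod_closed (prop_pred (fun y : N => exists x, f x = y)).
Proof.
apply: zmod_closed_prop => [|_ _ [x <-] [y <-]]; first by exists 0; rewrite linear0.
by exists (x - y); rewrite linearB.
Qed.

Definition image_of : zmodClosed N := zmod_closed_pack image_closed.

Definition coker_mod : Type := Quotient.quot image_of.
HB.instance Definition _ := GRing.Zmodule.on coker_mod.

Definition coker_pi (y : N) : coker_mod := (\pi_(Quotient.quot image_of) y)%qT.

Lemma coker_pi_is_additive : zmod_morphism coker_pi.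
Proof. exact: (raddfB (\pi_(Quotient.quot image_of))%qT). Qed.
HB.instance Definition _ :=
  GRing.isZmodMorphism.Build N coker_mod coker_pi coker_pi_is_additive.

Lemma coker_piD : {morph coker_pi : y z / y + z}.
Proof. exact: raddfD. Qed.

Lemma coker_pi_surj (q : coker_mod) : exists y, coker_pi y = q.
Proof. by exists (repr q); rewrite /coker_pi reprK. Qed.

Lemma coker_pi_eq0 (y : N) : coker_pi y = 0 <-> exists x, f x = y.
Proof.
have -> : (coker_pi y = 0) <-> (coker_pi y = coker_pi 0) by rewrite raddf0.
have e : (y \in image_of) = (coker_pi y == coker_pi 0).
  by have := Quotient.idealrBE image_of y 0; rewrite subr0.
split=> [h|h]; first by have : y \in image_of by [rewrite e h]; move=> /prop_predP.
by apply/eqP; rewrite -e; apply/prop_predP.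
Qed.

Lemma coker_pi_eq (y z : N) : coker_pi y = coker_pi z <-> exists x, f x = y - z.
Proof.
rewrite -coker_pi_eq0 coker_pi_is_additive; split=> [->|/eqP].
  exact: subrr.
by rewrite subr_eq0 => /eqP.
Qed.

Definition coker_scale (a : R) (q : coker_mod) : coker_mod :=
  coker_pi (a *: repr (q : Quotient.quot image_of)).

Lemma coker_scaleE (a : R) (y : N) : coker_scale a (coker_pi y) = coker_pi (a *: y).
Proof.
apply/coker_pi_eq; have : coker_pi (repr (coker_pi y : Quotient.quot image_of)) =
  coker_pi y by rewrite /coker_pi reprK.
by move=> /coker_pi_eq[x fx]; exists (a *: x); rewrite linearZ fx -scalerBr.
Qed.

Lemma coker_scalerA a b v :
  coker_scale a (coker_scale b v) = coker_scale (a * b) v.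
Proof. by have [y <-] := coker_pi_surj v; rewrite !coker_scaleE scalerA. Qed.

Lemma coker_scale1r : left_id 1 coker_scale.
Proof.
by move=> v; have [y <-] := coker_pi_surj v; rewrite coker_scaleE scale1r.
Qed.

Lemma coker_scalerDr : right_distributive coker_scale +%R.
Proof.
move=> a u v; have [y <-] := coker_pi_surj v; have [z <-] := coker_pi_surj u.
by rewrite -coker_piD !coker_scaleE scalerDr coker_piD.
Qed.

Lemma coker_scalerDl v : {morph coker_scale^~ v : a b / a + b}.
Proof.
move=> a b; have [y <-] := coker_pi_surj v.
by rewrite !coker_scaleE scalerDl coker_piD.
Qed.

HB.instance Definition _ := GRing.Zmodule_isLmodule.Build R coker_mod
  coker_scalerA coker_scale1r coker_scalerDr coker_scalerDl.

Lemma coker_pi_linear : linear coker_pi.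
Proof. by move=> a x y; rewrite coker_piD -coker_scaleE. Qed.

End QuotientModule.

(** * Kernels, cokernels and the morphisms inverted by the Serre quotient *)

Section SerreMorphisms.
Variables (G : zmodType) (A : graded_ring G).
Implicit Types M N : graded_module A.

Lemma zero_dsum : direct_sum (fun _ : G => zmod_closed_pack
  (zmod_closed_prop (P := fun _ : 'rV[A^c]_0 => True) I (fun _ _ _ _ => I))).
Proof.
split=> [x|s c _ _ _ i _]; last by rewrite [c i]thinmx0.
by rewrite [x]thinmx0; apply: in_sum0.
Qed.

Definition zero_gm : graded_module A :=
  {| gm_mod := 'rV[A^c]_0; gm_dsum := zero_dsum;
     gm_act := fun _ _ _ _ _ _ => introT (prop_predP _ _) I |}.

Lemma zero_map_linear M N : linear (fun _ : M => 0 : N).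
Proof. by move=> a x y; rewrite scaler0 addr0. Qed.

Definition zero_hom M N : graded_hom M N :=
  ghom_pack (@zero_map_linear M N) (fun g _ _ => rpred0 (gm_comp N g)).

Lemma zero_gm_zero : @is_zero_object (Gr A) zero_gm.
Proof.
move=> X; split.
  exists (zero_hom X zero_gm); split=> // h _; apply: graded_hom_ext => x.
  by rewrite [RHS]thinmx0 [LHS]thinmx0.
exists (zero_hom zero_gm X); split=> // h _; apply: graded_hom_ext => x.
by rewrite [x]thinmx0 !linear0.
Qed.

Lemma zero_morP M N (f : graded_hom M N) :
  @is_zero_mor (Gr A) M N f <-> forall x, sval f x = 0.
Proof.
split=> [[Z [a [b [Z0 ->]]]] x|f0]; last first.
  exists zero_gm, (zero_hom M zero_gm), (zero_hom zero_gm N).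
  by split; [exact: zero_gm_zero|apply: graded_hom_ext => x; rewrite f0].
have [_ [h [_ hu]]] := Z0 Z.
have e : graded_hom_id Z = zero_hom Z Z.
  exact: etrans (esym (hu (graded_hom_id Z) I)) (hu (zero_hom Z Z) I).
have az : sval a x = 0.
  exact: (congr1 (fun k : graded_hom Z Z => sval k (sval a x)) e).
by rewrite /= az linear0.
Qed.

Section KernelCokernelObjects.
Variables (M N : graded_module A) (f : graded_hom M N).

Lemma ker_comp_closed (g : G) :
  zmod_closed (prop_pred (fun m : M => m \in gm_comp M g /\ sval f m = 0)).
Proof.
apply: zmod_closed_prop => [|x y [xg fx] [yg fy]].
  by rewrite rpred0 linear0.
by rewrite rpredB // linearB fx fy subrr.
Qed.

Definition ker_comp (g : G) : zmodClosed M :=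
  zmod_closed_pack (ker_comp_closed g).

Lemma ker_ind : independent ker_comp.
Proof.
move=> s c us cD s0; apply: ((gm_dsum M).2 s c us) => // i.
by have /prop_predP[] := cD i.
Qed.

Lemma ker_act (g h : G) (m : M) (a : A) :
  m \in ker_comp g -> a \in gr_comp A h -> (a : A^c) *: m \in ker_comp (g + h).
Proof.
move=> /prop_predP[mg fm] ah; apply/prop_predP.
by split; [exact: gm_act|rewrite linearZ_LR fm scaler0].
Qed.

Definition ker_family : graded_family A :=
  {| gf_mod := M; gf_comp := ker_comp; gf_ind := ker_ind; gf_act := ker_act |}.

Definition ker_gm : graded_module A := gsum ker_family.

Lemma ker_gm_eq0 (x : ker_gm) : sval f (val x) = 0.
Proof.
have /prop_predP xs := valP x.
elim/(in_sum_ind xs): _ => [|y z fy fz|g y _ /prop_predP[]//].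
  exact: linear0.
by rewrite linearD fy fz addr0.
Qed.

Lemma ker_incl_deg : @degree_preserving _ _ ker_gm M val.
Proof. by move=> g m /prop_predP[]. Qed.

Definition ker_incl : graded_hom ker_gm M :=
  @ghom_pack _ _ ker_gm M val (@gsum_val_linear _ _ ker_family) ker_incl_deg.

Lemma ker_inclP : @is_kernel (Gr A) M N f ker_gm ker_incl.
Proof.
split; first by apply/zero_morP => x; apply: ker_gm_eq0.
move=> T h /zero_morP fh.
have hD g t : t \in gm_comp T g -> sval h t \in ker_comp g.
  by move=> tg; apply/prop_predP; split; [exact: (svalP h)|exact: fh].
exists (gsum_lift (L := ker_family) hD).
split=> [|u uh]; first exact: graded_hom_ext.
by apply: graded_hom_ext => x; apply: val_inj; rewrite /= -uh.
Qed.

Let Q : lmodType A^c := coker_mod (sval f).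

Lemma coker_comp_closed (g : G) : zmod_closed (prop_pred
  (fun q : Q => exists2 n : N, n \in gm_comp N g & coker_pi (sval f) n = q)).
Proof.
apply: zmod_closed_prop => [|_ _ [x xg <-] [y yg <-]].
  by exists 0; rewrite ?rpred0 ?raddf0.
by exists (x - y); rewrite ?rpredB ?raddfB.
Qed.

Definition coker_comp (g : G) : zmodClosed Q :=
  zmod_closed_pack (coker_comp_closed g).

(** Independence says that the image of f is a graded submodule: a vanishing
    sum of homogeneous classes lifts to some f x, and its component of degree i
    is f applied to the component of x. *)
Lemma coker_dsum : direct_sum coker_comp.
Proof.
split=> [q|s c us cD s0 i si].
  have [y <-] := coker_pi_surj q.
  elim/(in_sum_ind ((gm_dsum N).1 y)): _ => [|u v hu hv|g n _ ng].
  - by rewrite raddf0; apply: in_sum0.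
  - by rewrite raddfD; apply: in_sumD.
  - by apply: (in_sum1 (i := g)) => //; apply/prop_predP; exists n.
have cD' j : exists n, n \in gm_comp N j /\ coker_pi (sval f) n = c j.
  by have /prop_predP[n nj e] := cD j; exists n.
pose d j := sval (cid (cD' j)).
have dj j : d j \in gm_comp N j by rewrite /d; case: cid => n [].
have dE j : coker_pi (sval f) (d j) = c j by rewrite /d; case: cid => n [].
have : coker_pi (sval f) (\sum_(j <- s) d j) = 0.
  rewrite (big_morph _ (coker_piD (sval f)) (raddf0 _)).
  by under eq_bigr do rewrite dE.
move=> /coker_pi_eq0[x fx]; rewrite -dE; apply/coker_pi_eq0.
exists (proj (gm_dsum M) (pred1 i) x).
rewrite -graded_hom_proj.
apply: proj_unique; first by apply: in_sum1 (dj i); apply: eqxx.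
rewrite fx (bigD1_seq i) //= addrAC subrr add0r -big_filter.
apply: in_sum_big => j; rewrite mem_filter => /andP[ji _].
exact: in_sum1 (dj j).
Qed.

Lemma coker_act (g h : G) (q : Q) (a : A) :
  q \in coker_comp g -> a \in gr_comp A h -> (a : A^c) *: q \in coker_comp (g + h).
Proof.
move=> /prop_predP[n ng <-] ah; apply/prop_predP; exists ((a : A^c) *: n).
  exact: gm_act.
by rewrite -coker_scaleE.
Qed.

Definition coker_gm : graded_module A :=
  {| gm_mod := Q; gm_comp := coker_comp; gm_dsum := coker_dsum;
     gm_act := coker_act |}.

Lemma coker_proj_deg : @degree_preserving _ _ N coker_gm (coker_pi (sval f)).
Proof. by move=> g n ng; apply/prop_predP; exists n. Qed.

Definition coker_proj : graded_hom N coker_gm :=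
  @ghom_pack _ _ N coker_gm _ (coker_pi_linear (sval f)) coker_proj_deg.

Lemma coker_projP : @is_cokernel (Gr A) M N f coker_gm coker_proj.
Proof.
split; first by apply/zero_morP => x; apply/coker_pi_eq0; exists x.
move=> T h /zero_morP hf.
pose u (q : coker_gm) : T := sval h (sval (cid (coker_pi_surj q))).
have uE n : u (coker_pi (sval f) n) = sval h n.
  rewrite /u; case: cid => n' /= /coker_pi_eq[x fx]; apply/eqP.
  by rewrite -subr_eq0 -linearB -fx; apply/eqP/hf.
have lu : linear u.
  move=> a p q; have [y <-] := coker_pi_surj p; have [z <-] := coker_pi_surj q.
  by rewrite -coker_pi_linear !uE linearP.
have du : degree_preserving u.
  by move=> g _ /prop_predP[n ng <-]; rewrite uE; apply: (svalP h).
exists (ghom_pack lu du); split=> [|v vh].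
  by apply: graded_hom_ext => n; apply: uE.
apply: graded_hom_ext => q; have [y <-] := coker_pi_surj q.
by rewrite [LHS]uE -vh.
Qed.

(** The kernel and cokernel witnessing serre_mor are arbitrary; comparing them
    with the concrete ones by their universal properties turns the condition
    into bijectivity in the degrees of O. *)
Lemma serre_morP (O : zmodClosed G) :
  @serre_mor (Gr A) (vanishes_on A O) M N f <->
  (forall g m, g \in O -> m \in gm_comp M g -> sval f m = 0 -> m = 0) /\
  (forall g n, g \in O -> n \in gm_comp N g -> exists m, sval f m = n).
Proof.
split=> [[[K [k [[_ kU] K0]]] [C [q [[_ qU] C0]]]]|[finj fsurj]]; split.
- move=> g m gO mg fm.
  have [|u [/(congr1 (fun k => sval k)) ku _]] := kU ker_gm ker_incl.
    by apply/zero_morP => x; apply: ker_gm_eq0.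
  have mK : m \in @gsum_pred _ _ ker_family.
    by apply/prop_predP/(in_sum1 (i := g)) => //; apply/prop_predP.
  pose m' : ker_gm := Sub m mK.
  have um : sval u m' = 0.
    by apply: (K0 g) => //; apply: (svalP u); apply/prop_predP.
  have := congr1 (fun v : {linear ker_gm -> M} => v m') ku.
  by rewrite /= um linear0 => <-.
- move=> g n gO ng; apply/coker_pi_eq0.
  have [|u [/(congr1 (fun k => sval k)) uq _]] := qU coker_gm coker_proj.
    by apply/zero_morP => x; apply/coker_pi_eq0; exists x.
  have := congr1 (fun v : {linear N -> coker_gm} => v n) uq.
  have qn : sval q n = 0 := C0 g _ gO (svalP q g n ng).
  by rewrite /= qn linear0 => <-.
- exists ker_gm, ker_incl; split; first exact: ker_inclP.
  move=> g m gO /prop_predP[mg fm]; apply: val_inj.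
  exact: (finj g).
- exists coker_gm, coker_proj; split; first exact: coker_projP.
  move=> g _ gO /prop_predP[n ng <-]; apply/coker_pi_eq0.
  exact: (fsurj g).
Qed.

End KernelCokernelObjects.

End SerreMorphisms.

(** * Restriction to the degrees of a subgroup *)

Definition restrict_scalars (R S : pzRingType) (phi : {rmorphism S -> R})
  (M : lmodType R) : Type := M.

Section RestrictScalars.
Variables (R S : pzRingType) (phi : {rmorphism S -> R}) (M : lmodType R).

HB.instance Definition _ := GRing.Zmodule.on (restrict_scalars phi M).

Definition rs_scale (a : S) (m : restrict_scalars phi M) :
  restrict_scalars phi M := phi a *: (m : M).

Lemma rs_scalerA a b v : rs_scale a (rs_scale b v) = rs_scale (a * b) v.
Proof. by rewrite /rs_scale scalerA rmorphM. Qed.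

Lemma rs_scale1r : left_id 1 rs_scale.
Proof. by move=> v; rewrite /rs_scale rmorph1 scale1r. Qed.

Lemma rs_scalerDr : right_distributive rs_scale +%R.
Proof. by move=> a u v; apply: scalerDr. Qed.

Lemma rs_scalerDl v : {morph rs_scale^~ v : a b / a + b}.
Proof. by move=> a b; rewrite /rs_scale rmorphD scalerDl. Qed.

HB.instance Definition _ := GRing.Zmodule_isLmodule.Build S
  (restrict_scalars phi M) rs_scalerA rs_scale1r rs_scalerDr rs_scalerDl.

End RestrictScalars.

Lemma rs_linear (R S : pzRingType) (phi : {rmorphism S -> R})
    (M N : lmodType R) (f : {linear M -> N}) :
  linear (f : restrict_scalars phi M -> restrict_scalars phi N).
Proof. by move=> a x y; apply: linearP. Qed.

Section RestrictionFunctor.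
Variables (G : zmodType) (A : graded_ring G) (O : zmodClosed G).
Local Notation AO := (restricted_graded_ring A O).
Implicit Types M N : graded_module A.

Definition res_val : AO^c -> A^c := fun a => val (a : res_ring A O).

Lemma res_val_zmod_morphism : zmod_morphism res_val.
Proof. by []. Qed.
HB.instance Definition _ :=
  GRing.isZmodMorphism.Build AO^c A^c res_val res_val_zmod_morphism.

Lemma res_val_monoid_morphism : monoid_morphism res_val.
Proof. by []. Qed.
HB.instance Definition _ :=
  GRing.isMonoidMorphism.Build AO^c A^c res_val res_val_monoid_morphism.

Lemma in_sum_subgroup (V : zmodType) (D : G -> zmodClosed V) x :
  in_sum D O x <-> in_sum (fun w : subgroup O => D (val w)) predT x.
Proof.
split=> xO.
  elim/(in_sum_ind xO): _ => [|y z|g y gO yg].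
  - exact: in_sum0.
  - exact: in_sumD.
  - exact: (@in_sum1 _ _ _ _ (Sub g gO : subgroup O)).
elim/(in_sum_ind xO): _ => [|y z|w y _ yw].
- exact: in_sum0.
- exact: in_sumD.
- exact: in_sum1 (valP w) yw.
Qed.

Definition res_mod M : lmodType AO^c := restrict_scalars res_val M.

Definition res_mod_comp M (w : subgroup O) : zmodClosed (res_mod M) :=
  gm_comp M (val w).

Lemma res_mod_ind M : independent (@res_mod_comp M).
Proof.
apply: independent_disjoint => w x xw xc.
apply: (in_sum_disjoint (P := pred1 (val w)) (gm_dsum M).2).
  by apply: (in_sum1 (i := val w)) => //; apply: eqxx.
elim/(in_sum_ind xc): _ => [|y z|v y vw yv].
- exact: in_sum0.
- exact: in_sumD.
- by apply: (in_sum1 (i := val v)); rewrite ?inE ?(inj_eq val_inj).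
Qed.

Lemma res_mod_act M (g h : subgroup O) (m : res_mod M) (a : AO) :
  m \in res_mod_comp M g -> a \in gr_comp AO h ->
  (a : AO^c) *: m \in res_mod_comp M (g + h).
Proof. exact: gm_act. Qed.

Definition res_family M : graded_family AO :=
  {| gf_mod := res_mod M; gf_comp := @res_mod_comp M;
     gf_ind := @res_mod_ind M; gf_act := @res_mod_act M |}.

Definition res_gm M : graded_module AO := gsum (res_family M).

Definition res_hom M N (f : graded_hom M N) : graded_hom (res_gm M) (res_gm N) :=
  gsum_map (L := res_family M) (L' := res_family N)
    (u := linear_pack (@rs_linear _ _ res_val M N (sval f)))
    (fun w x xw => svalP f (val w) x xw).

Lemma res_homE M N (f : graded_hom M N) x :
  val (sval (res_hom f) x) = sval f (val x).
Proof. by []. Qed.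

Lemma res_valD M (x y : res_gm M) : val (x + y) = (val x : M) + val y.
Proof. exact: gsum_valD. Qed.

Lemma res_valZ M (b : AO^c) (x : res_gm M) :
  val (b *: x) = res_val b *: (val x : M).
Proof. exact: gsum_valZ. Qed.

Lemma res_hom_id M : res_hom (graded_hom_id M) = graded_hom_id (res_gm M).
Proof. by apply: graded_hom_ext => x; apply: val_inj. Qed.

Lemma res_hom_comp M N P (g : graded_hom N P) (f : graded_hom M N) :
  res_hom (graded_hom_comp g f) = graded_hom_comp (res_hom g) (res_hom f).
Proof. by apply: graded_hom_ext => x; apply: val_inj. Qed.

Definition res_functor : functor (Gr A) (Gr AO) :=
  {| fob := res_gm : Gr A -> Gr AO; fmap := res_hom;
     fmap_id := res_hom_id; fmap_comp := res_hom_comp |}.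

Lemma res_proj_subproof M (m : M) :
  (proj (gm_dsum M) O m : res_mod M) \in @gsum_pred _ _ (res_family M).
Proof. by apply/prop_predP/in_sum_subgroup/proj_in. Qed.

Definition res_proj M (m : M) : res_gm M :=
  (Sub (proj (gm_dsum M) O m : res_family M) (res_proj_subproof m)
    : gsum_type (res_family M)).

Lemma res_projD M (x y : M) : res_proj (x + y) = res_proj x + res_proj y.
Proof. by apply: val_inj; rewrite /= projD. Qed.

Lemma res_projK M (x : res_gm M) : res_proj (val x : M) = x.
Proof.
apply: val_inj => /=; apply: proj_id; apply/in_sum_subgroup.
by have /prop_predP := valP x.
Qed.

Lemma res_proj_in M g (m : M) : g \in O -> m \in gm_comp M g ->
  val (res_proj m) = m.
Proof. by move=> gO mg; apply/proj_id/(in_sum1 gO). Qed.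

Lemma res_proj_notin M g (m : M) :
  g \notin O -> m \in gm_comp M g -> res_proj m = 0.
Proof. by move=> gO mg; apply/val_inj/proj_eq0/(in_sum1 (i := g)). Qed.

(** The projection onto the degrees in O is A_O-linear, because A_O preserves
    both the degrees in O and those outside. *)
Lemma res_projZ M (b : AO) (m : M) :
  res_proj (((val b : A) : A^c) *: m) = (b : AO^c) *: res_proj m.
Proof.
apply: val_inj => /=.
have bO : in_sum (gr_comp A) O (val b) by have /asboolP := valP b.
apply: (proj_biadd (op := fun (x : M) (a : A) => (a : A^c) *: x)
  (gm_dsum M) (gm_dsum M) _ _ _ bO) => [x y a|x a c|g h x a].
- exact: scalerDr.
- exact: scalerDl.
- exact: gm_act.
Qed.

Lemma res_proj_nat M N (f : graded_hom M N) (m : M) :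
  res_proj (sval f m) = sval (res_hom f) (res_proj m).
Proof. by apply: val_inj; rewrite res_homE /=; apply: graded_hom_proj. Qed.

(** Both sides say that f is bijective in the degrees of O, so the Serre
    quotient inverts exactly what restriction inverts. *)
Lemma serre_mor_res M N (f : graded_hom M N) :
  @serre_mor (Gr A) (vanishes_on A O) M N f <->
  @is_iso (Gr AO) _ _ (res_hom f).
Proof.
rewrite serre_morP; split=> [[finj fsurj]|fiso].
  apply: graded_iso => [w x xw fx|w n nw].
    apply: val_inj; apply: (finj (val w)) => //; first exact: valP.
    by rewrite -res_homE fx.
  have [m fm] := fsurj (val w) (val n : N) (valP w) nw.
  by exists (res_proj m); rewrite -res_proj_nat fm res_projK.
split=> [g m gO mg fm|g n gO ng].
  rewrite -(res_proj_in gO mg).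
  have -> // : res_proj m = 0.
  apply: (graded_iso_inj fiso); rewrite -res_proj_nat fm.
  by apply: val_inj; apply: proj_id; apply: in_sum0.
have [x fx] := graded_iso_surj fiso (res_proj n).
by exists (val x); rewrite -res_homE fx (res_proj_in gO ng).
Qed.

(** * The right adjoint of restriction *)

Section Coinduced.
Variable N : graded_module AO.

(** Right A_O-linearity: the coinduced module is Hom(A, N) over A_O, on which A
    acts through left multiplication on the source. *)
Definition coind_spec (f : A -> N) : Prop :=
  (forall a b, f (a + b) = f a + f b) /\
  (forall (a : A) (b : AO), f (a * val b) = (b : AO^c) *: f a).

Lemma coind_closed : zmod_closed (prop_pred coind_spec).
Proof.
apply: zmod_closed_prop => [|f g [fD fZ] [gD gZ]].
  by split=> *; [rewrite [RHS]addr0|rewrite [RHS]scaler0].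
split=> a b; rewrite !opprfctE !addrfctE.
  by rewrite fD gD opprD addrACA.
by rewrite fZ gZ scalerBr.
Qed.

HB.instance Definition _ :=
  GRing.isZmodClosed.Build (A -> N) (prop_pred coind_spec) coind_closed.

Definition coind_type : Type := {f : A -> N | f \in prop_pred coind_spec}.
HB.instance Definition _ := SubChoice.on coind_type.
HB.instance Definition _ := [SubChoice_isSubZmodule of coind_type by <:].

Lemma coindD (f : coind_type) a b : val f (a + b) = val f a + val f b.
Proof. by have /prop_predP[->] := valP f. Qed.

Lemma coindZ (f : coind_type) (a : A) (b : AO) :
  val f (a * val b) = (b : AO^c) *: val f a.
Proof. by have /prop_predP[_ ->] := valP f. Qed.

Lemma coind_scale_subproof (x : A^c) (f : coind_type) :
  (fun a : A => val f ((x : A) * a)) \in prop_pred coind_spec.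
Proof.
by apply/prop_predP; split=> a b; rewrite ?mulrDr ?coindD // mulrA coindZ.
Qed.

Definition coind_scale (x : A^c) (f : coind_type) : coind_type :=
  Sub (fun a : A => val f ((x : A) * a)) (coind_scale_subproof x f).

Lemma coind_ext (f g : coind_type) : val f =1 val g -> f = g.
Proof. by move=> /funext/val_inj. Qed.

Lemma coind_scalerA a b v :
  coind_scale a (coind_scale b v) = coind_scale (a * b) v.
Proof. by apply: coind_ext => z /=; rewrite mulrA. Qed.

Lemma coind_scale1r : left_id 1 coind_scale.
Proof. by move=> v; apply: coind_ext => z /=; rewrite mul1r. Qed.

Lemma coind_scalerDr : right_distributive coind_scale +%R.
Proof. by move=> a u v; apply: coind_ext. Qed.

Lemma coind_scalerDl v : {morph coind_scale^~ v : a b / a + b}.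
Proof.
by move=> a b; apply: coind_ext => z; rewrite /= mulrDl coindD.
Qed.

HB.instance Definition _ := GRing.Zmodule_isLmodule.Build A^c coind_type
  coind_scalerA coind_scale1r coind_scalerDr coind_scalerDl.

Lemma coind_valD (f g : coind_type) a : val (f + g) a = val f a + val g a.
Proof. by []. Qed.

Lemma coind_valZ (x : A^c) (f : coind_type) a :
  val (x *: f) a = val f ((x : A) * a).
Proof. by []. Qed.

(** A map of degree g sends A_h to the component of N of degree g + h, which
    has to be read as 0 when g + h is not in O. *)
Definition coind_homogeneous (g : G) (f : coind_type) : Prop :=
  forall h a, a \in gr_comp A h ->
    (forall w : subgroup O, val w = g + h -> val f a \in gm_comp N w) /\
    (g + h \notin O -> val f a = 0).

Lemma coind_comp_closed g : zmod_closed (prop_pred (coind_homogeneous g)).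
Proof.
apply: zmod_closed_prop => [h a _|f f' fg fg' h a ah].
  by split=> // w _; apply: rpred0.
split=> [w wE|gh]; rewrite /= opprfctE addrfctE.
  by rewrite rpredB // ?(fg h a ah).1 ?(fg' h a ah).1.
by rewrite (fg h a ah).2 ?(fg' h a ah).2 ?subrr.
Qed.

Definition coind_comp g : zmodClosed coind_type :=
  zmod_closed_pack (coind_comp_closed g).

Lemma coind_homogeneous_ext (f f' : coind_type) :
  (forall h a, a \in gr_comp A h -> val f a = val f' a) -> f = f'.
Proof.
move=> ff; apply: coind_ext; apply: (direct_sum_ext (gr_dsum A)) ff.
  exact: coindD.
exact: coindD.
Qed.

(** For a of degree h, the values at a of maps of distinct degrees g lie in
    components of N of distinct degrees g + h. *)
Lemma coind_ind : independent coind_comp.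
Proof.
apply: independent_disjoint => g f /prop_predP fg fc.
apply: coind_homogeneous_ext => h a ah.
case ghO: (g + h \in O); last by apply: (fg h a ah).2; rewrite ghO.
pose w : subgroup O := Sub (g + h) ghO.
apply: (in_sum_disjoint (P := pred1 w) (gm_dsum N).2).
  by apply: in_sum1 ((fg h a ah).1 w erefl); apply: eqxx.
elim/(in_sum_ind fc): _ => [|f1 f2 h1 h2|g' f' g'g /prop_predP fg'].
- exact: in_sum0.
- exact: in_sumD.
case ghO': (g' + h \in O).
  pose w' : subgroup O := Sub (g' + h) ghO'.
  apply: in_sum1 ((fg' h a ah).1 w' erefl).
  apply: contra g'g => /eqP/(congr1 val) /= e.
  by apply/eqP/(addIr h).
rewrite (fg' h a ah).2 ?ghO' //; exact: in_sum0.
Qed.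

Lemma coind_act (g h : G) (f : coind_type) (x : A) :
  f \in coind_comp g -> x \in gr_comp A h -> (x : A^c) *: f \in coind_comp (g + h).
Proof.
move=> /prop_predP fg xh; apply/prop_predP => k a ak /=.
have := fg (h + k) (x * a) (gr_mul xh ak).
by rewrite addrA.
Qed.

Definition coind_family : graded_family A :=
  {| gf_mod := coind_type; gf_comp := coind_comp; gf_ind := coind_ind;
     gf_act := coind_act |}.

Definition coind : graded_module A := gsum coind_family.

End Coinduced.

Section CoinducedMap.
Variables (N N' : graded_module AO) (f : graded_hom N N').

Lemma coind_map_subproof (u : coind_type N) :
  (fun a => sval f (val u a)) \in prop_pred (@coind_spec N').
Proof.
by apply/prop_predP; split=> a b; rewrite ?coindD ?coindZ ?linearD ?linearZ_LR.
Qed.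

Definition coind_map_fun (u : coind_type N) : coind_type N' :=
  Sub (fun a => sval f (val u a)) (coind_map_subproof u).

Lemma coind_map_linear : linear (coind_map_fun : coind_family N -> coind_family N').
Proof. by move=> a x y; apply: coind_ext => z /=; apply: linearD. Qed.

Lemma coind_map_deg g u : u \in gf_comp (coind_family N) g ->
  linear_pack coind_map_linear u \in gf_comp (coind_family N') g.
Proof.
move=> /prop_predP ug; apply/prop_predP => h a ah /=; split=> [w wE|gh].
  by apply: (svalP f); apply: (ug h a ah).1.
by rewrite (ug h a ah).2 ?linear0.
Qed.

Definition coind_map : graded_hom (coind N) (coind N') := gsum_map coind_map_deg.

End CoinducedMap.

Lemma coind_map_id (N : graded_module AO) :
  coind_map (graded_hom_id N) = graded_hom_id (coind N).
Proof. by apply: graded_hom_ext => x; apply/val_inj/val_inj. Qed.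

Lemma coind_map_comp (N N' N'' : graded_module AO) (g : graded_hom N' N'')
  (f : graded_hom N N') :
  coind_map (graded_hom_comp g f) =
  graded_hom_comp (coind_map g) (coind_map f).
Proof. by apply: graded_hom_ext => x; apply/val_inj/val_inj. Qed.

Definition coind_functor : functor (Gr AO) (Gr A) :=
  {| fob := coind : Gr AO -> Gr A; fmap := coind_map;
     fmap_id := coind_map_id; fmap_comp := coind_map_comp |}.

Section Counit.
Variable N : graded_module AO.

Definition coind_ev1 (x : coind N) : N := val (val x : coind_type N) 1.

Lemma coind_ev1D (x y : coind N) : coind_ev1 (x + y) = coind_ev1 x + coind_ev1 y.
Proof. by rewrite /coind_ev1 [val (x + y)]gsum_valD; apply: coind_valD. Qed.

Lemma coind_ev1Z (b : AO) (x : coind N) :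
  coind_ev1 (((val b : A) : A^c) *: x) = (b : AO^c) *: coind_ev1 x.
Proof.
rewrite /coind_ev1 -coindZ [val (_ *: x)]gsum_valZ mul1r.
have := coind_valZ ((val b : A) : A^c) (val x : coind_type N) 1.
by rewrite mulr1.
Qed.

Definition counit_fun (x : res_gm (coind N)) : N := coind_ev1 (val x).

Lemma counit_linear : linear counit_fun.
Proof.
move=> a x y; rewrite /counit_fun [val (_ + y)]res_valD coind_ev1D.
by rewrite [val (a *: x)]res_valZ coind_ev1Z.
Qed.

Lemma counit_deg : degree_preserving counit_fun.
Proof.
move=> w x /prop_predP xw.
by apply: (xw 0 1 (gr_one A)).1; rewrite addr0.
Qed.

Definition counit : graded_hom (res_gm (coind N)) N :=
  ghom_pack counit_linear counit_deg.

(** A map f of degree in O vanishes on the A_h with h outside O, and on A_O it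
    is given by f a = f 1 * a. So f 1 determines f, and can be prescribed: n is
    the value at 1 of the map sending a to n times the A_O-part of a. *)
Lemma counit_iso : @is_iso (Gr AO) _ _ counit.
Proof.
apply: graded_iso => [w x /prop_predP xw x1|w n nw].
  apply/val_inj/val_inj/coind_homogeneous_ext => h a ah.
  case whO: (val w + h \in O); last by rewrite (xw h a ah).2 ?whO.
  have hO : h \in O by rewrite -(addKr (val w) h) rpredD ?rpredN ?(valP w).
  have aO : a \in res_pred O by apply/asboolP/(in_sum1 hO).
  pose b : AO := (Sub a aO : res_ring A O).
  have -> : a = 1 * val b by rewrite mul1r.
  by rewrite coindZ [X in _ *: X]x1 scaler0.
have pO a : proj (gr_dsum A) O a \in res_pred O by apply/asboolP/proj_in.
pose p a : AO := (Sub (proj (gr_dsum A) O a) (pO a) : res_ring A O).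
have pD a b : p (a + b) = p a + p b by apply: val_inj; rewrite /= projD.
have pM a (b : AO) : p (a * val b) = p a * b.
  apply: val_inj => /=.
  have bO : in_sum (gr_comp A) O (val b) by have /asboolP := valP b.
  apply: (proj_biadd (gr_dsum A) (gr_dsum A) _ _ _ bO) => [x y z|x y z|].
  - exact: mulrDl.
  - exact: mulrDr.
  - exact: gr_mul.
have fS : (fun a : A => (p a : AO^c) *: n) \in prop_pred (@coind_spec N).
  apply/prop_predP; split=> a b; first by rewrite pD scalerDl.
  by rewrite pM scalerA.
pose f : coind_family N :=
  (Sub (fun a : A => (p a : AO^c) *: n) fS : coind_type N).
have fw : f \in gf_comp (coind_family N) (val w).
  apply/prop_predP => h a ah; split=> [v vE|whO] /=.
    have hO : h \in O.
      by rewrite -(addKr (val w) h) rpredD ?rpredN ?(valP w) // -vE (valP v).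
    have -> : v = w + Sub h hO by apply: val_inj.
    apply: gm_act => //; rewrite unfold_in /= proj_id //; exact: in_sum1 ah.
  have -> : p a = 0; last by rewrite scale0r.
  apply: val_inj; apply: proj_eq0; apply: in_sum1 ah.
  by apply: contra whO => hO; rewrite rpredD ?(valP w).
pose f' : coind N := (Sub f (gsum_in fw) : gsum_type (coind_family N)).
have fw' : f' \in gf_comp (res_family (coind N)) w by [].
exists (Sub (f' : res_family (coind N)) (gsum_in fw')
  : gsum_type (res_family (coind N))).
have p1 : p 1 = 1.
  by apply: val_inj; apply: proj_id; apply: in_sum1 (rpred0 O) (gr_one A).
suff : (p 1 : AO^c) *: n = n by [].
by rewrite p1 scale1r.
Qed.

End Counit.

Lemma counit_nat (N N' : graded_module AO) (f : graded_hom N N') :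
  graded_hom_comp (counit N') (res_hom (coind_map f)) =
  graded_hom_comp f (counit N).
Proof. exact: graded_hom_ext. Qed.

Section Unit.
Variable M : graded_module A.

Lemma unit_subproof (m : M) :
  (fun a : A => res_proj ((a : A^c) *: m)) \in prop_pred (@coind_spec (res_gm M)).
Proof.
apply/prop_predP; split=> a b; first by rewrite scalerDl res_projD.
by rewrite -res_projZ scalerA.
Qed.

Definition unit_fun (m : M) : coind_family (res_gm M) :=
  (Sub (fun a : A => res_proj ((a : A^c) *: m)) (unit_subproof m)
    : coind_type (res_gm M)).

Lemma unit_linear : linear unit_fun.
Proof.
move=> a x y; apply: coind_ext => z /=.
by rewrite addrfctE /= scalerDr scalerA res_projD.
Qed.

Lemma unit_deg g m : m \in gm_comp M g ->
  linear_pack unit_linear m \in gf_comp (coind_family (res_gm M)) g.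
Proof.
move=> mg; apply/prop_predP => h a ah; split=> [w wE|ghO] /=.
  have am := gm_act mg ah.
  have ghO : g + h \in O by rewrite -wE (valP w).
  suff : val (res_proj ((a : A^c) *: m)) \in gm_comp M (val w) by [].
  by rewrite (res_proj_in ghO am) wE.
exact: res_proj_notin ghO (gm_act mg ah).
Qed.

Definition unit_hom : graded_hom M (coind (res_gm M)) := gsum_lift unit_deg.

Lemma counit_unit :
  graded_hom_comp (counit (res_gm M)) (res_hom unit_hom) =
  graded_hom_id (res_gm M).
Proof.
apply: graded_hom_ext => x.
have : res_proj ((1 : A^c) *: (val x : M)) = x by rewrite scale1r res_projK.
by [].
Qed.

(** By the triangle identity counit_unit, the restriction of the unit is a
    one-sided inverse of the isomorphism counit, hence an isomorphism. *)
Lemma unit_serre_mor : @serre_mor (Gr A) (vanishes_on A O) _ _ unit_hom.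
Proof.
apply/serre_mor_res.
exact: (@is_iso_linv (Gr AO) _ _ _ _ (counit_iso _) counit_unit).
Qed.

End Unit.

Lemma unit_nat M N (f : graded_hom M N) :
  graded_hom_comp (unit_hom N) f =
  graded_hom_comp (coind_map (res_hom f)) (unit_hom M).
Proof.
apply: graded_hom_ext => m; apply/val_inj/coind_ext => a.
by rewrite /= -linearZ_LR res_proj_nat.
Qed.

Lemma serre_quotient_restriction :
  equivalent_categories (serre_quotient (vanishes_on A O)) (Gr AO).
Proof.
apply: (@localisation_equivalence _ _ _ res_functor _ coind_functor
  unit_hom counit).
- by move=> X Y s /serre_mor_res.
- exact: unit_nat.
- exact: unit_serre_mor.
- exact: counit_nat.
- exact: counit_iso.
Qed.

End RestrictionFunctor.

(** * The degree zero case *)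

Section IsomorphicRings.
Variables (R S : pzRingType) (phi : {rmorphism S -> R}).

Definition rs_functor_map (M N : lmodType R) (f : {linear M -> N}) :
    {linear restrict_scalars phi M -> restrict_scalars phi N} :=
  linear_pack (@rs_linear _ _ phi M N f).

Lemma rs_functor_id (M : lmodType R) :
  rs_functor_map (linear_id M) = linear_id (restrict_scalars phi M).
Proof. exact: linear_ext. Qed.

Lemma rs_functor_comp (M N P : lmodType R) (g : {linear N -> P})
    (f : {linear M -> N}) :
  rs_functor_map (linear_comp g f) =
  linear_comp (rs_functor_map g) (rs_functor_map f).
Proof. exact: linear_ext. Qed.

Definition rs_functor : functor (left_mod R) (left_mod S) :=
  {| fob := fun M : left_mod R =>
       (restrict_scalars phi M : lmodType S) : left_mod S;
     fmap := rs_functor_map;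
     fmap_id := rs_functor_id; fmap_comp := rs_functor_comp |}.

End IsomorphicRings.

(** The identity of the underlying group is linear in both directions, since
    a and phi (psi a) are the same scalar. *)
Lemma rs_functor_cancel (R S : pzRingType) (phi : {rmorphism S -> R})
    (psi : {rmorphism R -> S}) :
  cancel psi phi ->
  naturally_isomorphic (functor_comp (rs_functor psi) (rs_functor phi))
    (functor_id (left_mod R)).
Proof.
move=> psiK.
have to_linear (M : lmodType R) :
    linear (id : restrict_scalars psi (restrict_scalars phi M) -> M).
  by move=> a x y; rewrite -{2}(psiK a).
have from_linear (M : lmodType R) :
    linear (id : M -> restrict_scalars psi (restrict_scalars phi M)).
  by move=> a x y; rewrite -{1}(psiK a).
exists (fun M => linear_pack (to_linear M)); split=> [M N f|M].
  exact: linear_ext.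
by exists (linear_pack (from_linear M)); split; apply: linear_ext.
Qed.

Lemma left_mod_equiv (R S : pzRingType) (phi : {rmorphism S -> R})
    (psi : {rmorphism R -> S}) :
  cancel psi phi -> cancel phi psi ->
  equivalent_categories (left_mod R) (left_mod S).
Proof.
by move=> psiK phiK; exists (rs_functor phi), (rs_functor psi);
  split; apply: rs_functor_cancel.
Qed.

Section TrivialGrading.
Variables (T : zmodType) (T0 : forall t : T, t = 0) (B : graded_ring T).

Definition forget_grading : functor (Gr B) (right_mod B) :=
  {| fob := fun M : Gr B => (gm_mod M : right_mod B);
     fmap := fun M N (f : graded_hom M N) => sval f;
     fmap_id := fun M => erefl; fmap_comp := fun M N P g f => erefl |}.

Section TrivialModule.
Variable V : lmodType B^c.

Definition full_comp (_ : T) : zmodClosed V := zmod_closed_pack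
  (zmod_closed_prop (P := fun _ : V => True) I (fun _ _ _ _ => I)).

Lemma full_compP (t : T) (v : V) : v \in full_comp t.
Proof. exact/prop_predP. Qed.

Lemma full_dsum : direct_sum full_comp.
Proof.
split=> [v|]; first exact: in_sum1 (full_compP 0 v).
apply: independent_disjoint => t v _ vt.
elim/(in_sum_ind vt): _ => // [x y -> ->|t' x]; first exact: addr0.
by rewrite !inE (T0 t) (T0 t') eqxx.
Qed.

Definition full_graded : graded_module B :=
  {| gm_mod := V; gm_comp := full_comp; gm_dsum := full_dsum;
     gm_act := fun _ _ _ _ _ _ => full_compP _ _ |}.

End TrivialModule.

Definition full_graded_hom (V W : lmodType B^c) (f : {linear V -> W}) :
    graded_hom (full_graded V) (full_graded W) :=
  exist (fun f : {linear full_graded V -> full_graded W} => degree_preserving f)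
    f (fun t v _ => full_compP t (f v)).

Lemma full_graded_id (V : lmodType B^c) :
  full_graded_hom (linear_id V) = graded_hom_id (full_graded V).
Proof. exact: graded_hom_ext. Qed.

Lemma full_graded_comp (V W U : lmodType B^c) (g : {linear W -> U})
    (f : {linear V -> W}) :
  full_graded_hom (linear_comp g f) =
  graded_hom_comp (full_graded_hom g) (full_graded_hom f).
Proof. exact: graded_hom_ext. Qed.

Definition full_grading : functor (right_mod B) (Gr B) :=
  {| fob := full_graded : right_mod B -> Gr B; fmap := full_graded_hom;
     fmap_id := full_graded_id; fmap_comp := full_graded_comp |}.

Lemma gm_comp_trivial (M : graded_module B) (t : T) (m : M) :
  m \in gm_comp M t.
Proof.
apply: in_sum_pred1; apply: in_sum_sub ((gm_dsum M).1 m) => s _.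
by rewrite inE (T0 s) (T0 t).
Qed.

(** Over the trivial group a grading is no structure: every element has degree
    0, and every linear map preserves degrees. *)
Lemma trivially_graded_equiv : equivalent_categories (Gr B) (right_mod B).
Proof.
exists forget_grading, full_grading; split.
  exists (fun M => exist (fun f : {linear full_graded (gm_mod M) -> M} =>
    degree_preserving f) (linear_id _) (fun t m _ => gm_comp_trivial t (m : M))).
  split=> [M N f|M]; first exact: graded_hom_ext.
  exists (exist (fun f : {linear M -> full_graded (gm_mod M)} =>
    degree_preserving f) (linear_id _) (fun t m _ => full_compP t (m : gm_mod M))).
  by split; apply: graded_hom_ext.
exists (fun V => linear_id V); split=> [V W f|V]; first exact: linear_ext.
by exists (linear_id V); split; apply: linear_ext.
Qed.

End TrivialGrading.

Section DegreeZeroRing.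
Variables (G : zmodType) (A : graded_ring G).
Local Notation AO := (restricted_graded_ring A (zero_subgroup G)).

Lemma zero_part_resP (x : A) :
  (x \in res_pred (zero_subgroup G)) = (x \in @zero_part_pred _ A).
Proof.
apply/idP/idP => [/asboolP|xA]; first exact: in_sum_pred1.
by apply/asboolP/(in_sum1 (i := 0)); rewrite ?inE.
Qed.

Lemma to_zero_part_subproof (x : res_ring A (zero_subgroup G)) :
  val x \in @zero_part_pred _ A.
Proof. by rewrite -zero_part_resP; apply: valP. Qed.

Definition to_zero_part (x : AO^c) : (zero_part A)^c :=
  (Sub (val (x : res_ring A (zero_subgroup G))) (to_zero_part_subproof x)
    : zero_part A).

Lemma of_zero_part_subproof (x : zero_part A) :
  val x \in res_pred (zero_subgroup G).
Proof. by rewrite zero_part_resP; apply: valP. Qed.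

Definition of_zero_part (x : (zero_part A)^c) : AO^c :=
  (Sub (val (x : zero_part A)) (of_zero_part_subproof x)
    : res_ring A (zero_subgroup G)).

Lemma to_zero_part_additive : zmod_morphism to_zero_part.
Proof. by move=> x y; apply: val_inj. Qed.

Lemma to_zero_part_multiplicative : monoid_morphism to_zero_part.
Proof. by split=> [|x y]; apply: val_inj. Qed.

Lemma of_zero_part_additive : zmod_morphism of_zero_part.
Proof. by move=> x y; apply: val_inj. Qed.

Lemma of_zero_part_multiplicative : monoid_morphism of_zero_part.
Proof. by split=> [|x y]; apply: val_inj. Qed.

HB.instance Definition _ := GRing.isZmodMorphism.Build AO^c (zero_part A)^c
  to_zero_part to_zero_part_additive.
HB.instance Definition _ := GRing.isMonoidMorphism.Build AO^c (zero_part A)^c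
  to_zero_part to_zero_part_multiplicative.
HB.instance Definition _ := GRing.isZmodMorphism.Build (zero_part A)^c AO^c
  of_zero_part of_zero_part_additive.
HB.instance Definition _ := GRing.isMonoidMorphism.Build (zero_part A)^c AO^c
  of_zero_part of_zero_part_multiplicative.

Lemma zero_subgroup_eq0 (t : subgroup (zero_subgroup G)) : t = 0.
Proof. by apply: val_inj; apply/eqP; have := valP t. Qed.

Lemma degree_zero_equiv :
  equivalent_categories (Gr AO) (right_mod (zero_part A)).
Proof.
apply: equivalent_categories_trans (trivially_graded_equiv zero_subgroup_eq0 _) _.
apply: (@left_mod_equiv _ _ of_zero_part to_zero_part) => x; exact: val_inj.
Qed.

End DegreeZeroRing.

Theorem lemma6p3p1 (G : zmodType) (A : graded_ring G) :
  (forall O : zmodClosed G,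
     equivalent_categories
       (serre_quotient (vanishes_on A O))
       (Gr (restricted_graded_ring A O))) /\
  equivalent_categories
    (serre_quotient (vanishes_on A (zero_subgroup G)))
    (right_mod (zero_part A)).
Proof.
split=> [O|]; first exact: serre_quotient_restriction.
exact: equivalent_categories_trans (serre_quotient_restriction _ _)
  (degree_zero_equiv A).
Qed.
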